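(* Let $(E,\|\cdot\|)$ be a complete RN module with base $(\Omega,\mathcal F,P)$ such that $E$ has full support, let $\Phi$ be a real-valued Young function, and let $|\cdot|_\Phi$ be either the Luxemburg norm $|\cdot|_{\Phi L}$ or the Orlicz norm $|\cdot|_{\Phi O}$ on $L^\Phi$, with $\|\cdot\|_\Phi$ the corresponding induced norm on $L^\Phi(E)$. Then $(L^\Phi(E),\|\cdot\|_\Phi)$ is strictly convex if and only if $(L^\Phi,|\cdot|_\Phi)$ is strictly convex and $(E,\|\cdot\|)$ is random strictly convex.
   Context: Let $(\Omega,\mathcal F,P)$ be a probability space and $K=\mathbb R$ or $\mathbb C$. $L^0(\mathcal F,K)$ is the algebra of equivalence classes (under a.s. equality) of $\mathcal F$-measurable $K$-valued random variables; $L^0=L^0(\mathcal F,\mathbb R)$ is ordered by $\xi\leqslant\eta$ iff $\xi\le\eta$ a.s.; $L^0_+=\{\xi\in L^0:\xi\geqslant 0\}$. $\mathbb E$ denotes expectation with respect to $P$. Measurable sets are identified when they differ by a $P$-null set, $\tilde{\mathcal F}$ is the set of such classes, $I_D$ is the class of the indicator of $D$, and $[\xi\ne0]$ etc. is the class of $\{\omega:\xi(\omega)\neq0\}$. ''$\xi<\eta$ on $D$'' means $\xi(\omega)<\eta(\omega)$ for almost all $\omega\in D$. A random normed module (RN module) over $K$ with base $(\Omega,\mathcal F,P)$ is a left module $E$ over $L^0(\mathcal F,K)$ with a map $\|\cdot\|:E\to L^0_+$ such that (1) $\|x\|=0$ iff $x=\theta$ (the null element); (2) $\|\xi x\|=|\xi|\,\|x\|$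 for all $\xi\in L^0(\mathcal F,K)$, $x\in E$; (3) $\|x_1+x_2\|\leqslant\|x_1\|+\|x_2\|$. $E$ carries the $(\varepsilon,\lambda)$-topology, the metrizable linear topology in which $x_n\to x$ iff $\|x_n-x\|\to 0$ in probability; completeness of $E$ is with respect to it. $E$ has full support if $[\xi(E)\neq0]=\Omega$ up to a null set, where $\xi(E)=\vee\{\|x\|:x\in E\}$ (essential supremum). A Young function is a convex, left-continuous $\Phi:[0,\infty)\to[0,\infty]$ with $\lim_{t\to0}\Phi(t)=\Phi(0)=0$ and $\lim_{t\to\infty}\Phi(t)=\infty$. Its conjugate is $\Psi(s)=\sup_{t\ge0}\{ts-\Phi(t)\}$, also a Young function (possibly taking the value $\infty$). $L^\Phi=\{\xi\in L^0:\mathbb E[\Phi(c|\xi|)]<\infty\text{ for some }c>0\}$, and $L^\Psi$ similarly. Luxemburg norm: $|\xi|_{\Phi L}=\inf\{\lambda>0:\mathbb E[\Phi(|\xi|/\lambda)]\le1\}$, and $|\cdot|_{\Psi L}$ similarly. Orlicz norm: $|\xi|_{\Phi O}=\sup\{|\mathbb E[\xi\eta]|:\eta\in L^\Psi,|\eta|_{\Psi L}\le1\}$. $L^\Phi(E)=\{x\in E:\|x\|\in L^\Phi\}$ with induced norm $\|x\|_\Phi=\big|\|x\|\big|_\Phi$. A normed space $X$ is strictly convex if $\|\frac{x+y}2\|<1$ for any distinct $x,y\in X$ with $\|x\|=\|y\|=1$. For $x,y\in E$ put $A_x=[\|x\|\ne0]$ and $B_{xy}=A_x\cap A_y\cap A_{x-y}$.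 The random unit sphere is $S(E)=\{x\in E:x\ne\theta,\ \|I_{A_x}x\|=I_{A_x}\}$. $E$ is random strictly convex if for any $x,y\in S(E)$ with $P(B_{xy})>0$ one has $\|\frac{x+y}2\|<1$ on $B_{xy}$. *)

(* Defs.v *)
From HB Require Import structures.
From mathcomp Require Import all_boot all_order all_algebra.
From mathcomp Require Import complex.
From mathcomp Require Import all_classical all_reals all_analysis measurable_realfun.
From mathcomp Require Import lra.

Set Implicit Arguments.
Unset Strict Implicit.
Unset Printing Implicit Defensive.

Import Order.TTheory GRing.Theory Num.Theory.

Local Open Scope classical_set_scope.
Local Open Scope ring_scope.

(* Selects the scalar field K = R or K = R[i]. *)
Variant scalar_kind := RealScalars | ComplexScalars.

Section scalars.
Context (R : realType).

Definition scalar_field (k : scalar_kind) : numFieldType :=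
  match k with RealScalars => R | ComplexScalars => R[i] end.

Definition scalar (k : scalar_kind) : Type := scalar_field k.

HB.instance Definition _ k := Num.NumField.on (scalar k).
HB.instance Definition _ k := isPointed.Build (scalar k) 0.

Definition modulus (k : scalar_kind) : scalar k -> R :=
  match k return scalar k -> R with
  | RealScalars => fun x : R => `|x|
  | ComplexScalars => fun z : R[i] => ComplexField.Normc.normc z
  end.

Definition complex_coord (z : R[i]) : R * R := (complex.Re z, complex.Im z).

(* The Borel sigma-algebra of the scalar field; on R[i] it is the one transported
   from R * R, so that a function is measurable iff its real and imaginary parts
   are. *)
Definition scalar_measurable (k : scalar_kind) : set (set (scalar k)) :=
  match k return set (set (scalar k)) with
  | RealScalars => @measurable _ R
  | ComplexScalars =>
      preimage_set_system setT complex_coord (@measurable _ (R * R)%type)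
  end.

Lemma scalar_measurable_sigma k : sigma_algebra setT (@scalar_measurable k).
Proof.
case: k => /=; first exact: sigma_algebra_measurable.
by apply: sigma_algebra_preimage; exact: sigma_algebra_measurable.
Qed.

Lemma scalar_measurable0 k : @scalar_measurable k set0.
Proof. by case: (scalar_measurable_sigma k). Qed.

Lemma scalar_measurableC k (A : set (scalar k)) :
  scalar_measurable A -> scalar_measurable (~` A).
Proof.
by case: (scalar_measurable_sigma k) => _ + _ => /[apply]; rewrite setTD.
Qed.

Lemma scalar_measurable_bigcup k (F : (set (scalar k))^nat) :
  (forall i, scalar_measurable (F i)) -> scalar_measurable (\bigcup_i F i).
Proof. by case: (scalar_measurable_sigma k) => _ _; exact. Qed.

HB.instance Definition _ k := @isMeasurable.Build default_measure_display
  (scalar k) (@scalar_measurable k) (@scalar_measurable0 k)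
  (@scalar_measurableC k) (@scalar_measurable_bigcup k).

Section measurability.
Context d (T : measurableType d).

Lemma measurable_complexP (f : T -> scalar ComplexScalars) :
  measurable_fun setT f <->
  measurable_fun setT (fun w => complex.Re (f w : R[i])) /\
  measurable_fun setT (fun w => complex.Im (f w : R[i])).
Proof.
split=> [mf|[mre mim]].
- have mc : measurable_fun setT (fun w => complex_coord (f w)).
    move=> _ Y mY; apply: (mf measurableT (complex_coord @^-1` Y)).
    by exists Y => //; rewrite setTI.
  by have [] := (measurable_fun_pairP _).1 mc.
- move=> _ _ [B mB <-]; rewrite setTI.
  have mc : measurable_fun setT (fun w => complex_coord (f w)).
    exact: measurable_fun_pair.
  exact: (mc measurableT B mB).
Qed.

Lemma measurable_scalarD k (f g : T -> scalar k) :
  measurable_fun setT f -> measurable_fun setT g ->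
  measurable_fun setT (fun w => f w + g w).
Proof.
case: k f g => f g; first exact: measurable_funD.
move=> /measurable_complexP[f1 f2] /measurable_complexP[g1 g2].
apply/measurable_complexP; split.
- apply: (eq_measurable_fun (fun w => complex.Re (f w : R[i]) +
    complex.Re (g w : R[i]))); last exact: measurable_funD.
  by move=> w _; case: (f w) (g w) => [? ?] [? ?].
- apply: (eq_measurable_fun (fun w => complex.Im (f w : R[i]) +
    complex.Im (g w : R[i]))); last exact: measurable_funD.
  by move=> w _; case: (f w) (g w) => [? ?] [? ?].
Qed.

Lemma measurable_scalarM k (f g : T -> scalar k) :
  measurable_fun setT f -> measurable_fun setT g ->
  measurable_fun setT (fun w => f w * g w).
Proof.
case: k f g => f g; first exact: measurable_funM.
move=> /measurable_complexP[f1 f2] /measurable_complexP[g1 g2].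
apply/measurable_complexP; split.
- apply: (eq_measurable_fun (fun w =>
    complex.Re (f w : R[i]) * complex.Re (g w : R[i]) -
    complex.Im (f w : R[i]) * complex.Im (g w : R[i]))); last first.
    by apply: measurable_funB; exact: measurable_funM.
  by move=> w _; case: (f w) (g w) => [? ?] [? ?].
- apply: (eq_measurable_fun (fun w =>
    complex.Re (f w : R[i]) * complex.Im (g w : R[i]) +
    complex.Im (f w : R[i]) * complex.Re (g w : R[i]))); last first.
    by apply: measurable_funD; exact: measurable_funM.
  by move=> w _; case: (f w) (g w) => [? ?] [? ?].
Qed.

Lemma measurable_scalarN k (f : T -> scalar k) :
  measurable_fun setT f -> measurable_fun setT (fun w => - f w).
Proof.
move=> mf; apply: (eq_measurable_fun (fun w => -1 * f w)).
  by move=> w _; rewrite mulN1r.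
by apply: measurable_scalarM => //; exact: measurable_cst.
Qed.

Lemma measurable_modulus k (f : T -> scalar k) : measurable_fun setT f ->
  measurable_fun setT ((fun w => modulus (f w)) : T -> scalar RealScalars).
Proof.
case: k f => f.
  by move=> mf; exact: (measurableT_comp (@normr_measurable R setT)).
move=> /measurable_complexP[f1 f2].
apply: (eq_measurable_fun (fun w => Num.sqrt
  (complex.Re (f w : R[i]) ^+ 2 + complex.Im (f w : R[i]) ^+ 2))).
  by move=> w _; rewrite /modulus /=; case: (f w).
apply: (measurableT_comp (continuous_measurable_fun (@sqrt_continuous R))).
by apply: measurable_funD; apply: measurable_funX.
Qed.

End measurability.

Lemma modulus0 k : modulus (0 : scalar k) = 0.
Proof. by case: k; [exact: normr0|exact: ComplexField.Normc.normc0]. Qed.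

Lemma modulusN1 k : modulus (-1 : scalar k) = 1.
Proof.
case: k => /=; first by rewrite normrN1.
by rewrite /= oppr0 expr0n /= addr0 sqrrN expr1n sqrtr1.
Qed.

End scalars.

Definition L0 (R : realType) (d : measure_display) (T : measurableType d)
    (P : probability T R) (k : scalar_kind) : Type :=
  {mfun_ P, T >-> scalar R k}.

Section L0.
Context (R : realType) (d : measure_display) (T : measurableType d).
Context (P : probability T R).

HB.instance Definition _ k := Choice.on (L0 P k).
HB.instance Definition _ k := EqQuotient.on (L0 P k).

Section algebra.
Context (k : scalar_kind).

Definition L0_rep (xi : L0 P k) : T -> scalar R k := aqEqMfun_to_fun xi.

Definition mfun_of (f : T -> scalar R k) (mf : measurable_fun setT f) :
    {mfun T >-> scalar R k} :=
  HB.pack_for {mfun T >-> scalar R k} f (isMeasurableFun.Build _ _ _ _ f mf).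

Definition L0_class (f : T -> scalar R k) (mf : measurable_fun setT f) : L0 P k :=
  \pi_(L0 P k)%qT (mfun_of mf).

Lemma measurable_L0_rep (xi : L0 P k) : measurable_fun setT (L0_rep xi).
Proof. by apply: measurable_funPT. Qed.

Lemma L0_eqP (xi eta : L0 P k) :
  xi = eta <-> {ae P, forall w, L0_rep xi w = L0_rep eta w}.
Proof.
split=> [->|h]; first exact: aeW.
rewrite -(reprK xi) -(reprK eta); apply/eqP; rewrite eqmodE; apply/asboolP.
by apply: filterS h.
Qed.

Lemma L0_classE f (mf : measurable_fun setT f) :
  {ae P, forall w, L0_rep (L0_class mf) w = f w}.
Proof.
rewrite /L0_rep /aqEqMfun_to_fun.
have : (repr (L0_class mf) = mfun_of mf %[mod (L0 P k)])%qT by rewrite reprK.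
move=> /eqP; rewrite eqmodE => /asboolP.
by apply: filterS => w; exact.
Qed.

Definition L0_const (a : scalar R k) : L0 P k :=
  L0_class (measurable_cst a : measurable_fun setT (fun _ : T => a)).
Definition L0_add (xi eta : L0 P k) : L0 P k := L0_class
  (measurable_scalarD (measurable_L0_rep xi) (measurable_L0_rep eta)).
Definition L0_opp (xi : L0 P k) : L0 P k :=
  L0_class (measurable_scalarN (measurable_L0_rep xi)).
Definition L0_mul (xi eta : L0 P k) : L0 P k := L0_class
  (measurable_scalarM (measurable_L0_rep xi) (measurable_L0_rep eta)).

Let cstE a : {ae P, forall w, L0_rep (L0_const a) w = a}.
Proof. exact: L0_classE. Qed.
Let addE xi eta :
  {ae P, forall w, L0_rep (L0_add xi eta) w = L0_rep xi w + L0_rep eta w}.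
Proof. exact: L0_classE. Qed.
Let oppE xi : {ae P, forall w, L0_rep (L0_opp xi) w = - L0_rep xi w}.
Proof. exact: L0_classE. Qed.
Let mulE xi eta :
  {ae P, forall w, L0_rep (L0_mul xi eta) w = L0_rep xi w * L0_rep eta w}.
Proof. exact: L0_classE. Qed.

Let addA : associative L0_add.
Proof.
move=> x y z; apply/L0_eqP; near=> w.
rewrite (near (addE x (L0_add y z)) w)//
  (near (addE y z) w)//
  (near (addE (L0_add x y) z) w)//
  (near (addE x y) w)//.
exact: addrA.
Unshelve. all: by end_near. Qed.
Let addC : commutative L0_add.
Proof.
move=> x y; apply/L0_eqP; near=> w.
rewrite (near (addE x y) w)// (near (addE y x) w)//.
exact: addrC.
Unshelve. all: by end_near. Qed.
Let add0 : left_id (L0_const 0) L0_add.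
Proof.
move=> x; apply/L0_eqP; near=> w.
rewrite (near (addE (L0_const 0) x) w)// (near (cstE 0) w)//.
exact: add0r.
Unshelve. all: by end_near. Qed.
Let addN : left_inverse (L0_const 0) L0_opp L0_add.
Proof.
move=> x; apply/L0_eqP; near=> w.
rewrite (near (addE (L0_opp x) x) w)// (near (oppE x) w)// (near (cstE 0) w)//.
exact: addNr.
Unshelve. all: by end_near. Qed.

HB.instance Definition _ :=
  GRing.isZmodule.Build (L0 P k) addA addC add0 addN.

Let mulA : associative L0_mul.
Proof.
move=> x y z; apply/L0_eqP; near=> w.
rewrite (near (mulE x (L0_mul y z)) w)//
  (near (mulE y z) w)//
  (near (mulE (L0_mul x y) z) w)//
  (near (mulE x y) w)//.
exact: mulrA.
Unshelve. all: by end_near. Qed.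
Let mulC : commutative L0_mul.
Proof.
move=> x y; apply/L0_eqP; near=> w.
rewrite (near (mulE x y) w)// (near (mulE y x) w)//.
exact: mulrC.
Unshelve. all: by end_near. Qed.
Let mul1 : left_id (L0_const 1) L0_mul.
Proof.
move=> x; apply/L0_eqP; near=> w.
rewrite (near (mulE (L0_const 1) x) w)// (near (cstE 1) w)//.
exact: mul1r.
Unshelve. all: by end_near. Qed.
Let mulD : left_distributive L0_mul L0_add.
Proof.
move=> x y z; apply/L0_eqP; near=> w.
rewrite (near (mulE (L0_add x y) z) w)//
  (near (addE x y) w)//
  (near (addE (L0_mul x z) (L0_mul y z)) w)//
  (near (mulE x z) w)//
  (near (mulE y z) w)//.
exact: mulrDl.
Unshelve. all: by end_near. Qed.
Let one_neq0 : L0_const 1 != L0_const 0.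
Proof.
apply/eqP => /L0_eqP h.
have PT : (0 < P setT)%E by rewrite probability_setT.
have PF : ProperFilter (almost_everywhere P).
  exact: ae_properfilter_algebraOfSetsType.
have [w] : exists w : T, (1 : scalar R k) = 0.
  apply: (@filter_ex _ (almost_everywhere P)).
  near=> w; rewrite -(near (cstE 1) w)// -(near (cstE 0) w)//.
  by near: w.
by move/eqP; rewrite oner_eq0.
Unshelve. all: by end_near. Qed.

HB.instance Definition _ :=
  GRing.Zmodule_isComNzRing.Build (L0 P k) mulA mulC mul1 mulD one_neq0.

Definition L0_scale (a : scalar R k) (xi : L0 P k) : L0 P k :=
  L0_const a * xi.

Let scaleA a b x : L0_scale a (L0_scale b x) = L0_scale (a * b) x.
Proof.
rewrite /L0_scale mulrA; congr (_ * _); apply/L0_eqP; near=> w.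
by rewrite (near (mulE (L0_const a) (L0_const b)) w)// (near (cstE a) w)//
  (near (cstE b) w)// (near (cstE (a * b)) w).
Unshelve. all: by end_near. Qed.
Let scale1 : left_id 1 L0_scale.
Proof. by move=> x; exact: mul1r. Qed.
Let scaleDr : right_distributive L0_scale +%R.
Proof. by move=> a x y; exact: mulrDr. Qed.
Let scaleDl x : {morph L0_scale^~ x : a b / a + b}.
Proof.
move=> a b; rewrite /L0_scale -mulrDl; congr (_ * _); apply/L0_eqP; near=> w.
by rewrite (near (addE (L0_const a) (L0_const b)) w)// (near (cstE a) w)//
  (near (cstE b) w)// (near (cstE (a + b)) w).
Unshelve. all: by end_near. Qed.

HB.instance Definition _ := GRing.Zmodule_isLmodule.Build (scalar R k) (L0 P k)
  scaleA scale1 scaleDr scaleDl.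

Let scaleAl a (x y : L0 P k) : a *: (x * y) = a *: x * y.
Proof. exact: mulrA. Qed.

HB.instance Definition _ :=
  GRing.Lmodule_isLalgebra.Build (scalar R k) (L0 P k) scaleAl.
HB.instance Definition _ :=
  GRing.Lalgebra_isComAlgebra.Build (scalar R k) (L0 P k).

Lemma L0_rep0 : {ae P, forall w, L0_rep (0 : L0 P k) w = 0}.
Proof. exact: cstE. Qed.
Lemma L0_rep1 : {ae P, forall w, L0_rep (1 : L0 P k) w = 1}.
Proof. exact: cstE. Qed.
Lemma L0_repD (xi eta : L0 P k) :
  {ae P, forall w, L0_rep (xi + eta) w = L0_rep xi w + L0_rep eta w}.
Proof. exact: addE. Qed.
Lemma L0_repN (xi : L0 P k) : {ae P, forall w, L0_rep (- xi) w = - L0_rep xi w}.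
Proof. exact: oppE. Qed.
Lemma L0_repM (xi eta : L0 P k) :
  {ae P, forall w, L0_rep (xi * eta) w = L0_rep xi w * L0_rep eta w}.
Proof. exact: mulE. Qed.
Lemma L0_repZ a (xi : L0 P k) :
  {ae P, forall w, L0_rep (a *: xi) w = a * L0_rep xi w}.
Proof.
near=> w; rewrite (near (mulE (L0_const a) xi) w)//.
by rewrite (near (cstE a) w).
Unshelve. all: by end_near. Qed.

Lemma measurable_scalar_indic (A : set T) : measurable A ->
  measurable_fun setT (fun w => (w \in A)%:R : scalar R k).
Proof.
move=> mA _ Y mY; rewrite setTI.
rewrite [X in measurable X](_ : _ =
  (if 1 \in Y then A else set0) `|` (if 0 \in Y then ~` A else set0)).
  by apply: measurableU; case: ifP => // _; exact: measurableC.
apply/seteqP; split=> w /=.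
- have [wA|wA] := boolP (w \in A) => Yw.
    by left; rewrite mem_set//; exact: set_mem.
  by right; rewrite mem_set//; move: wA; rewrite notin_setE.
- case=> [|]; case: ifPn => // /set_mem Yw wA; first by rewrite mem_set.
  by rewrite memNset.
Qed.

Definition L0_indic (A : set T) (mA : measurable A) : L0 P k :=
  L0_class (measurable_scalar_indic mA).

End algebra.

Definition L0_abs k (xi : L0 P k) : L0 P RealScalars :=
  L0_class (measurable_modulus (measurable_L0_rep xi)).

Lemma L0_rep_abs k (xi : L0 P k) :
  {ae P, forall w, L0_rep (L0_abs xi) w = modulus (L0_rep xi w)}.
Proof. exact: L0_classE. Qed.

Definition rv (xi : L0 P RealScalars) : T -> R := L0_rep xi.

Definition L0_le (xi eta : L0 P RealScalars) : Prop :=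
  {ae P, forall w, rv xi w <= rv eta w}.

Definition L0_supp (xi : L0 P RealScalars) : set T := [set w | rv xi w != 0].

Lemma measurable_rv (xi : L0 P RealScalars) : measurable_fun setT (rv xi).
Proof. by move=> mT Y mY; exact: (measurable_L0_rep xi mT (Y := Y)). Qed.

Lemma measurable_L0_supp (xi : L0 P RealScalars) : measurable (L0_supp xi).
Proof.
rewrite (_ : L0_supp xi = rv xi @^-1` (~` [set 0])); last first.
  by apply/seteqP; split=> w /= /eqP.
rewrite -[X in measurable X]setTI; apply: (measurable_rv xi) => //.
exact: measurableC.
Qed.

End L0.

Arguments L0_class {R d T P k f} mf.
Arguments L0_indic {R d T P} k {A} mA.

HB.mixin Record isRNModule (R : realType) (d : measure_display)
    (T : measurableType d) (P : probability T R) (k : scalar_kind) E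
    & GRing.Lmodule (L0 P k) E := {
  rn_norm : E -> L0 P RealScalars;
  rn_norm_ge0 : forall x, L0_le 0 (rn_norm x);
  rn_norm_eq0 : forall x, rn_norm x = 0 <-> x = 0;
  rn_normZ : forall (xi : L0 P k) x, rn_norm (xi *: x) = L0_abs xi * rn_norm x;
  rn_normD : forall x y, L0_le (rn_norm (x + y)) (rn_norm x + rn_norm y)
}.

#[short(type="rnModType")]
HB.structure Definition RNModule (R : realType) (d : measure_display)
    (T : measurableType d) (P : probability T R) (k : scalar_kind) :=
  {E of GRing.Lmodule (L0 P k) E & isRNModule R d T P k E}.

Arguments rn_norm {R d T P k E} x : rename.

(* An L0-module as a vector space over the scalar field, through constants. *)
Definition restrict_scalars (R : realType) (d : measure_display)
  (T : measurableType d) (P : probability T R) (k : scalar_kind)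
  (E : lmodType (L0 P k)) : Type := E.

Section restrict_scalars.
Context (R : realType) (d : measure_display) (T : measurableType d).
Context (P : probability T R) (k : scalar_kind) (E : lmodType (L0 P k)).

HB.instance Definition _ := GRing.Zmodule.on (restrict_scalars E).

Let scale (a : scalar R k) (x : restrict_scalars E) : restrict_scalars E :=
  a%:A *: (x : E).

Let scaleA a b x : scale a (scale b x) = scale (a * b) x.
Proof. by rewrite /scale scalerA -scalerAl mul1r scalerA. Qed.
Let scale1 : left_id 1 scale.
Proof. by move=> x; rewrite /scale !scale1r. Qed.
Let scaleDr : right_distributive scale +%R.
Proof. by move=> a x y; exact: scalerDr. Qed.
Let scaleDl x : {morph scale^~ x : a b / a + b}.
Proof. by move=> a b; rewrite /scale !scalerDl. Qed.

HB.instance Definition _ := GRing.Zmodule_isLmodule.Build (scalar R k)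
  (restrict_scalars E) scaleA scale1 scaleDr scaleDl.

Lemma restrict_scalarsE (a : scalar R k) (x : restrict_scalars E) :
  a *: x = a%:A *: (x : E) :> E.
Proof. by []. Qed.

End restrict_scalars.

(* Carries the uniform structure of the (epsilon, lambda)-topology. *)
Definition eps_lambda (R : realType) (d : measure_display)
  (T : measurableType d) (P : probability T R) (k : scalar_kind)
  (E : rnModType P k) : Type := E.

Section eps_lambda.
Context (R : realType) (d : measure_display) (T : measurableType d).
Context (P : probability T R) (k : scalar_kind) (E : rnModType P k).

HB.instance Definition _ := Choice.on (eps_lambda E).

Let near_set (x y : E) (e : R) : set T := [set w | rv (rn_norm (x - y)) w < e].

Definition eps_lambda_entourage : set_system (eps_lambda E * eps_lambda E) :=
  [set A | exists e l : R, [/\ 0 < e, 0 < l &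
    [set xy : E * E |
      (1 - l%:E < P [set w | (rv (rn_norm (xy.1 - xy.2)%R) w < e)%R])%E]
    `<=` A]].

Let near_setE x y e :
  near_set x y e = rv (rn_norm (x - y)) @^-1` [set` `]-oo, e[].
Proof. by apply/seteqP; split=> w /=; rewrite in_itv. Qed.

Let measurable_near x y e : measurable (near_set x y e).
Proof.
by rewrite near_setE -[X in measurable X]setTI; apply: measurable_rv.
Qed.

Let P_ae_le (A B : set T) : measurable A -> measurable B ->
  {ae P, forall w, A w -> B w} -> (P A <= P B)%E.
Proof.
move=> mA mB h; have mD : measurable (A `\` B) by exact: measurableD.
rewrite (measureDI P mA mB) [X in (X + _)%E](_ : _ = 0%E); last first.
  apply: measure_negligible => //; apply: negligibleS h => w [Aw nBw] /=.
  by move=> /(_ Aw).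
by rewrite add0e; exact: measureIr.
Qed.

Let entourage_filter : Filter eps_lambda_entourage.
Proof.
split.
- by exists 1, 1; split.
- move=> A B [e1 [l1 [e10 l10 A1]]] [e2 [l2 [e20 l20 B2]]].
  exists (Num.min e1 e2), (Num.min l1 l2).
  split; [by rewrite lt_min e10|by rewrite lt_min l10|].
  move=> xy /= h; split; [apply: A1|apply: B2] => /=.
  + apply: (le_lt_trans _ (lt_le_trans h _)).
      by rewrite -!EFinB lee_fin lerD2l lerN2 ge_min lexx.
    apply: P_ae_le; [exact: (measurable_near xy.1 xy.2)..|].
    by apply: aeW => w /=; rewrite lt_min => /andP[].
  + apply: (le_lt_trans _ (lt_le_trans h _)).
      by rewrite -!EFinB lee_fin lerD2l lerN2 ge_min lexx orbT.
    apply: P_ae_le; [exact: (measurable_near xy.1 xy.2)..|].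
    by apply: aeW => w /=; rewrite lt_min => /andP[].
- by move=> A B AB [e [l [e0 l0 h]]]; exists e, l; split => // xy /h /AB.
Qed.

Let P_ae (A : set T) : measurable A -> {ae P, forall w, A w} -> P A = 1%E.
Proof.
move=> mA h; apply/eqP; rewrite eq_le probability_le1//=.
rewrite -(probability_setT P); apply: P_ae_le => //.
by apply: filterS h.
Qed.

Let entourage_diagonal A : eps_lambda_entourage A -> (diagonal `<=` A)%classic.
Proof.
move=> [e [l [e0 l0 h]]] [x y] /= xy; apply: h => /=.
have {xy}-> : x = y by [].
rewrite [X in P X](_ : _ = near_set y y e)// P_ae//.
  by rewrite -EFinB lte_fin ltrBlDr ltrDl.
have /L0_eqP h0 : rn_norm (y - y) = 0 by apply/rn_norm_eq0; rewrite subrr.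
near=> w; rewrite /near_set /rv /= (near h0 w)// (near (L0_rep0 P _) w)//.
Unshelve. all: by end_near. Qed.

Let rn_normB_sym (x y : E) : rn_norm (x - y) = rn_norm (y - x).
Proof.
rewrite -opprB -scaleN1r rn_normZ -[RHS]mul1r; congr (_ * _).
apply/L0_eqP; near=> w.
rewrite (near (L0_rep_abs (-1 : L0 P k)) w)// (near (L0_repN (1 : L0 P k)) w)//.
rewrite (near (L0_rep1 P k) w)// (near (L0_rep1 P RealScalars) w)//.
exact: modulusN1.
Unshelve. all: by end_near. Qed.

Let entourage_inv A :
  eps_lambda_entourage A -> eps_lambda_entourage (A^-1)%relation.
Proof.
move=> [e [l [e0 l0 h]]]; exists e, l; split => // -[x y] /= xy.
by apply: h => /=; rewrite rn_normB_sym.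
Qed.

Let entourage_split A : eps_lambda_entourage A ->
  exists2 B, eps_lambda_entourage B & (B \; B `<=` A)%relation.
Proof.
move=> [e [l [e0 l0 h]]].
exists [set xy : E * E |
  (1 - (l / 2)%:E < P (near_set xy.1 xy.2 (e / 2)))%E].
  by exists (e / 2), (l / 2); split => //; exact: divr_gt0.
move=> [x z] [y /= xy yz]; apply: h => /=.
set U := near_set x y (e / 2) in xy; set V := near_set y z (e / 2) in yz.
have mU : measurable U by exact: measurable_near.
have mV : measurable V by exact: measurable_near.
have PUV : (1 - l%:E < P (U `&` V))%E.
  have mUV : measurable (U `&` V) by exact: measurableI.
  have : (P U + P V - P (U `&` V) <= 1)%E.
    rewrite -measureUfinr//; first exact/probability_le1/measurableU.
    by rewrite (le_lt_trans (probability_le1 P mV))// ltry.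
  move: xy yz; rewrite -/U -/V.
  have PE A0 : measurable A0 -> exists p : R, P A0 = p%:E.
    by move=> mA0; exists (fine (P A0)); rewrite fineK// fin_num_measure.
  have [u ->] := PE _ mU; have [v ->] := PE _ mV; have [p ->] := PE _ mUV.
  rewrite -EFinD -!EFinB !lte_fin lee_fin.
  by move=> *; lra.
apply: (lt_le_trans PUV); apply: P_ae_le.
- exact: measurableI.
- exact: measurable_near.
- have tri := rn_normD (x - y) (y - z).
  rewrite addrA subrK in tri; near=> w => -[Uw Vw].
  rewrite /near_set/=; apply: (le_lt_trans (near tri w _)) => //.
  rewrite /rv (near (L0_repD (rn_norm (x - y)) (rn_norm (y - z))) w)//.
  by rewrite [ltRHS](splitr e); exact: ltrD.
Unshelve. all: by end_near. Qed.

HB.instance Definition _ := isUniform.Build (eps_lambda E)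
  entourage_filter entourage_diagonal entourage_inv entourage_split.

Lemma eps_lambda_entourageE :
  @entourage (eps_lambda E) = eps_lambda_entourage.
Proof. by []. Qed.

End eps_lambda.

(* Completeness as in [completeType], for a bare uniform space. *)
Definition complete_uniform (U : uniformType) : Prop :=
  forall F : set_system U, ProperFilter F -> cauchy F -> exists x : U, F --> x.

Section rn_modules.
Context (R : realType) (d : measure_display) (T : measurableType d).
Context (P : probability T R).

(* The least almost sure upper bound of a family; it takes values in [0, +oo]. *)
Definition is_ess_supremum (F : set (L0 P RealScalars)) (g : T -> \bar R) : Prop :=
  [/\ measurable_fun setT g,
      forall xi, F xi -> {ae P, forall w, ((rv xi w)%:E <= g w)%E}
    & forall h : T -> \bar R, measurable_fun setT h ->
        (forall xi, F xi -> {ae P, forall w, ((rv xi w)%:E <= h w)%E}) ->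
        {ae P, forall w, (g w <= h w)%E}].

Definition full_support (k : scalar_kind) (E : rnModType P k) : Prop :=
  exists g : T -> \bar R,
    is_ess_supremum (range (rn_norm : E -> L0 P RealScalars)) g /\
    {ae P, forall w, g w != 0%E}.

Definition A_set k (E : rnModType P k) (x : E) : set T := L0_supp (rn_norm x).

Definition B_set k (E : rnModType P k) (x y : E) : set T :=
  A_set x `&` A_set y `&` A_set (x - y).

Definition random_unit_sphere k (E : rnModType P k) : set E :=
  [set x | x <> 0 /\
    rn_norm (L0_indic k (measurable_L0_supp (rn_norm x)) *: x) =
    L0_indic RealScalars (measurable_L0_supp (rn_norm x))].

Definition random_strictly_convex k (E : rnModType P k) : Prop :=
  forall x y : E, random_unit_sphere x -> random_unit_sphere y ->
    (0 < P (B_set x y))%E ->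
    {ae P, forall w, B_set x y w ->
      rv (rn_norm ((2^-1 : scalar R k)%:A *: (x + y))) w < 1}.

End rn_modules.

Section young.
Context (R : realType).

(* A function on [0, +oo[ is represented by a function on R of which only the
   values at nonnegative arguments are constrained. *)
Definition young_function (Phi : R -> \bar R) : Prop :=
  [/\ forall t, 0 <= t -> (0 <= Phi t)%E,
      forall x y a : R, 0 <= x -> 0 <= y -> 0 <= a <= 1 ->
        (Phi (a * x + (1 - a) * y)%R <= a%:E * Phi x + (1 - a)%:E * Phi y)%E,
      forall t, 0 < t -> Phi s @[s --> t^'-] --> Phi t,
      Phi 0 = 0%E /\ Phi s @[s --> 0^'+] --> 0%E
    & Phi s @[s --> +oo%R] --> +oo%E].

Definition real_valued (Phi : R -> \bar R) : Prop :=
  forall t, 0 <= t -> Phi t \is a fin_num.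

(* Meaningful at s >= 0 only. *)
Definition conjugate (Phi : R -> \bar R) (s : R) : \bar R :=
  ereal_sup [set ((t * s)%:E - Phi t)%E | t in [set t | 0 <= t]].

Context (d : measure_display) (T : measurableType d) (P : probability T R).
Implicit Types (Phi : R -> \bar R) (xi : L0 P RealScalars).

Definition orlicz_space Phi : set (L0 P RealScalars) :=
  [set xi | exists2 c : R, 0 < c &
    (\int[P]_w Phi (c * `|rv xi w|)%R < +oo)%E].

Definition orlicz_module Phi k (E : rnModType P k) : set (restrict_scalars E) :=
  [set x | orlicz_space Phi (rn_norm (x : E))].

(* On [orlicz_space Phi] the infimum and the supremum below are those of
   nonempty sets of reals with the required bounds. *)
Definition luxemburg_norm Phi xi : R :=
  inf [set l : R | 0 < l /\ (\int[P]_w Phi (`|rv xi w| / l)%R <= 1)%E].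

Definition orlicz_norm Phi xi : R :=
  sup [set `|fine 'E_P[fun w => rv xi w * rv eta w]| | eta in
    [set eta | orlicz_space (conjugate Phi) eta /\
               luxemburg_norm (conjugate Phi) eta <= 1]].

End young.

Arguments orlicz_space {R d T} P Phi.
Arguments orlicz_module {R d T P} Phi {k} E.

(* [N] is the norm of the subspace [S]; its values off [S] are irrelevant. *)
Definition strictly_convex (R : realType) (K : numFieldType) (V : lmodType K)
    (S : set V) (N : V -> R) : Prop :=
  forall x y : V, S x -> S y -> x <> y -> N x = 1 -> N y = 1 ->
    N (2^-1 *: (x + y)) < 1.

(* Main.v *)
From Pilot Require Import Defs.
From mathcomp Require Import all_boot all_order all_algebra.
From mathcomp Require Import complex.
From mathcomp Require Import all_classical all_reals all_analysis.
From mathcomp Require Import measurable_realfun.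
From mathcomp Require Import ring lra.
Import Pilot.Defs.

(** Both norms on the Orlicz space are lattice norms: an element with smaller
    absolute value has smaller norm, the norm is positively homogeneous, and
    indicators of non-null sets have positive norm ([luxemburg_lattice_norm],
    [orlicz_lattice_norm]). The equivalence holds for every norm of this kind.

    If the module [L^Phi(E)] is strictly convex, then so is [L^Phi], because [E]
    contains a vector [e] of norm one everywhere ([exists_unit_norm]) and
    [xi |-> xi e] preserves norms ([strictly_convex_lattice]). Completeness and
    full support produce [e]: vectors with norm zero or one are glued so as to
    exhaust the support, and their limit in probability is taken.
    If [E] were not random strictly convex, two points of the random unit sphere
    would have a midpoint of norm one on a set [D] of positive probability on
    which they differ; cut down to [D] and scaled, they contradict strict
    convexity of the module ([strictly_convex_random]).

    Conversely, take distinct unit vectors [x] and [y] of the module. If their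
    random norms differ, the triangle inequality in [E], monotonicity, and strict
    convexity of [L^Phi] conclude. If the random norms coincide, random strict
    convexity makes the random norm of the midpoint smaller on a non-null set
    ([midpoint_norm_neq]). Monotonicity alone would not turn that into a strict
    inequality of norms, but strict convexity of [L^Phi] does: were the norm of
    the midpoint still one, then the whole segment between the two comparable
    random norms would lie on the unit sphere
    ([random_lattice_strictly_convex]). *)

Set Implicit Arguments.
Unset Strict Implicit.
Unset Printing Implicit Defensive.

Import Order.TTheory GRing.Theory Num.Theory.

Local Open Scope classical_set_scope.
Local Open Scope ring_scope.

(** * Real multipliers on a random normed module *)

Section real_scalars.
Context (R : realType).

Definition real_scalar (k : scalar_kind) : R -> scalar R k :=
  match k return R -> scalar R k with
  | RealScalars => fun r => r
  | ComplexScalars => fun r => r%:C%C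
  end.

Lemma real_scalarD k (a b : R) :
  real_scalar k (a + b) = real_scalar k a + real_scalar k b.
Proof. by case: k => //=; rewrite rmorphD. Qed.

Lemma real_scalar_nat k (n : nat) : real_scalar k n%:R = n%:R.
Proof. by case: k => //=; rewrite rmorph_nat. Qed.

Lemma real_scalarN1 k : real_scalar k (- 1) = - 1.
Proof. by case: k => //=; rewrite rmorphN1. Qed.

Lemma real_scalar_half k : real_scalar k 2^-1 = 2^-1.
Proof. by case: k => //=; rewrite fmorphV rmorph_nat. Qed.

Lemma modulus_real_scalar k (a : R) : modulus (real_scalar k a) = `|a|.
Proof. by case: k => //=; rewrite expr0n /= addr0 sqrtr_sqr. Qed.

Lemma measurable_real_scalar k d (T : measurableType d) (f : T -> R) :
  measurable_fun setT f -> measurable_fun setT (fun w => real_scalar k (f w)).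
Proof.
case: k => /= mf; first exact: mf.
by apply/measurable_complexP; split => //=; exact: measurable_cst.
Qed.

End real_scalars.

Arguments measurable_real_scalar {R} k {d T f} mf.

Section multipliers.
Context (R : realType) (d : measure_display) (T : measurableType d).
Context (P : probability T R).

(** Multiplying elements of a module over [L0 P k] by real functions treats
    both scalar fields at once, and the norm only sees the absolute value of
    the function. *)
Definition real_L0 k (f : T -> R) (mf : measurable_fun setT f) : L0 P k :=
  L0_class (measurable_real_scalar k mf).

Arguments real_L0 k {f} mf.

Lemma real_L0E k f (mf : measurable_fun setT f) :
  {ae P, forall w, L0_rep (real_L0 k mf) w = real_scalar k (f w)}.
Proof. exact: L0_classE. Qed.

Lemma rv_real_L0 f (mf : measurable_fun setT f) :
  {ae P, forall w, rv (real_L0 RealScalars mf) w = f w}.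
Proof. exact: (L0_classE P (measurable_real_scalar RealScalars mf)). Qed.

Lemma rvP (xi eta : L0 P RealScalars) :
  xi = eta <-> {ae P, forall w, rv xi w = rv eta w}.
Proof. exact: (L0_eqP xi eta). Qed.

Lemma rvD (xi eta : L0 P RealScalars) :
  {ae P, forall w, rv (xi + eta) w = rv xi w + rv eta w}.
Proof. exact: (L0_repD xi eta). Qed.

Lemma rvZ (a : R) (xi : L0 P RealScalars) :
  {ae P, forall w, rv ((a : scalar R RealScalars) *: xi) w = a * rv xi w}.
Proof. exact: (L0_repZ (a : scalar R RealScalars) xi). Qed.

Lemma rv0 : {ae P, forall w, rv (0 : L0 P RealScalars) w = 0}.
Proof. exact: (L0_rep0 P RealScalars). Qed.

Lemma L0_indicE k (A : set T) (mA : measurable A) :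
  L0_indic k mA = real_L0 k (measurable_indic mA) :> L0 P k.
Proof.
apply/L0_eqP; near=> w; rewrite (near (real_L0E k (measurable_indic mA)) w)//.
have -> : L0_rep (L0_indic k mA : L0 P k) w = (w \in A)%:R.
  near: w; exact: (@L0_classE _ _ _ P k _ (@measurable_scalar_indic _ _ _ k A mA)).
by rewrite indicE real_scalar_nat.
Unshelve. all: by end_near. Qed.

Lemma rv_indic (A : set T) (mA : measurable A) :
  {ae P, forall w, rv (L0_indic RealScalars mA : L0 P RealScalars) w = \1_A w}.
Proof. by rewrite L0_indicE; exact: rv_real_L0. Qed.

(** Turns almost sure statements about the points of a set into statements about
    its probability; all the arguments by contradiction go through it. *)
Lemma ae_not_null (A : set T) : measurable A ->
  {ae P, forall w, ~ A w} <-> P A = 0%E.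
Proof.
move=> mA; split=> [h|A0].
  by apply: measure_negligible => //; apply: negligibleS h => w Aw /= /(_ Aw).
by exists A; split => // w /= /contrapT.
Qed.

Lemma le_probability_ae (A B : set T) : measurable A -> measurable B ->
  {ae P, forall w, A w -> B w} -> (P A <= P B)%E.
Proof.
move=> mA mB h; have mD : measurable (A `\` B) by exact: measurableD.
rewrite (measureDI P mA mB) [X in (X + _)%E](_ : _ = 0%E).
  by rewrite add0e; exact: measureIr.
by apply/(ae_not_null mD); apply: filterS h => w AB [/AB].
Qed.

Section module.
Context (k : scalar_kind) (E : rnModType P k).
Implicit Types x y : E.

Lemma rv_norm_ge0 x : {ae P, forall w, 0 <= rv (rn_norm x) w}.
Proof.
have h0 := rn_norm_ge0 x; near=> w; rewrite -(near rv0 w)//; near: w.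
exact: h0.
Unshelve. all: by end_near. Qed.

Lemma rv_norm_triangle x y : {ae P, forall w,
  rv (rn_norm (x + y)) w <= rv (rn_norm x) w + rv (rn_norm y) w}.
Proof.
have h := rn_normD x y; near=> w; rewrite -(near (rvD (rn_norm x) (rn_norm y)) w)//.
by near: w; exact: h.
Unshelve. all: by end_near. Qed.

Lemma rv_norm_eq0 x : x = 0 <-> {ae P, forall w, rv (rn_norm x) w = 0}.
Proof.
rewrite -rn_norm_eq0 rvP; split=> h; near=> w.
  by rewrite (near h w)// (near rv0 w).
by rewrite (near h w)// (near rv0 w).
Unshelve. all: by end_near. Qed.

Lemma rv_normM f (mf : measurable_fun setT f) x : {ae P, forall w,
  rv (rn_norm (real_L0 k mf *: x)) w = `|f w| * rv (rn_norm x) w}.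
Proof.
rewrite rn_normZ; near=> w.
have -> : rv (L0_abs (real_L0 k mf) * rn_norm x) w =
    rv (L0_abs (real_L0 k mf)) w * rv (rn_norm x) w.
  by near: w; exact: (L0_repM (L0_abs (real_L0 k mf)) (rn_norm x)).
congr (_ * _); rewrite /rv (near (L0_rep_abs (real_L0 k mf)) w)//.
by rewrite (near (real_L0E k mf) w)// modulus_real_scalar.
Unshelve. all: by end_near. Qed.

Lemma half_real_L0 :
  (2^-1 : scalar R k)%:A = real_L0 k (measurable_cst (2^-1 : R)) :> L0 P k.
Proof.
apply/L0_eqP; near=> w; rewrite (near (real_L0E k (measurable_cst _)) w)//.
rewrite (near (L0_repZ (2^-1) (1 : L0 P k)) w)// (near (L0_rep1 P k) w)// mulr1.
by rewrite -real_scalar_half.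
Unshelve. all: by end_near. Qed.

Lemma rv_norm_half x : {ae P, forall w,
  rv (rn_norm ((2^-1 : scalar R k)%:A *: x)) w = 2^-1 * rv (rn_norm x) w}.
Proof.
rewrite half_real_L0; apply: filterS (rv_normM (measurable_cst (2^-1 : R)) x).
by move=> w ->; rewrite ger0_norm// invr_ge0.
Qed.

Lemma rv_normN x :
  {ae P, forall w, rv (rn_norm (- x)) w = rv (rn_norm x) w}.
Proof.
have -> : - x = real_L0 k (measurable_cst (-1 : R)) *: x.
  rewrite -scaleN1r; congr (_ *: _); apply/L0_eqP; near=> w.
  rewrite (near (real_L0E k (measurable_cst _)) w)//.
  rewrite (near (L0_repN (1 : L0 P k)) w)// (near (L0_rep1 P k) w)//.
  by rewrite real_scalarN1.
apply: filterS (rv_normM (measurable_cst (-1 : R)) x).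
by move=> w ->; rewrite normrN1 mul1r.
Unshelve. all: by end_near. Qed.

Lemma rv_normB x y : {ae P, forall w,
  rv (rn_norm (x - y)) w <= rv (rn_norm x) w + rv (rn_norm y) w}.
Proof.
near=> w; rewrite -(near (rv_normN y) w)//.
by near: w; exact: rv_norm_triangle.
Unshelve. all: by end_near. Qed.

Lemma rv_norm_dist x y : {ae P, forall w,
  `|rv (rn_norm x) w - rv (rn_norm y) w| <= rv (rn_norm (x - y)) w}.
Proof.
have hx := rv_norm_triangle (x - y) y; rewrite subrK in hx.
have hy := rv_norm_triangle (y - x) x; rewrite subrK -(opprB x) in hy.
near=> w; rewrite ler_distl; apply/andP; split.
  rewrite lerBlDr -(near (rv_normN (x - y)) w)// addrC; near: w; exact: hy.
by rewrite addrC; near: w; exact: hx.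
Unshelve. all: by end_near. Qed.

(** On the set where [y] vanishes, adding [y] is invisible to the norm: this makes
    gluing along a measurable set work without any disjointness of supports. *)
Lemma rv_normD_off x y : {ae P, forall w, rv (rn_norm y) w = 0 ->
  rv (rn_norm (x + y)) w = rv (rn_norm x) w}.
Proof.
have h := rv_norm_dist (x + y) x; rewrite addrAC subrr add0r in h.
apply: filterS h => w + y0; rewrite y0 normr_le0 subr_eq0.
by move/eqP.
Qed.

End module.
End multipliers.

Arguments real_L0 {R d T P} k {f} mf.

(** * Existence of a vector of norm one *)

Section exhaustion.
Context (R : realType) (d : measure_display) (T : measurableType d).
Context (P : probability T R) (k : scalar_kind) (E : rnModType P k).
Implicit Types x y : E.

(** The class over which supports are exhausted. Restricting to it makes a vector
    vanish off the set where it has norm one, so that successive glued vectors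
    differ only on the small newly covered set. *)
Definition zero_one_norm x :=
  {ae P, forall w, rv (rn_norm x) w = 0 \/ rv (rn_norm x) w = 1}.

Lemma measurable_A_set x : measurable (A_set x).
Proof. exact: measurable_L0_supp. Qed.

Definition support_prob x : R := fine (P (A_set x)).

Lemma support_probE x : P (A_set x) = (support_prob x)%:E.
Proof. by rewrite fineK// fin_num_measure//; exact: measurable_A_set. Qed.

Lemma support_prob_le1 x : support_prob x <= 1.
Proof.
by rewrite -lee_fin -support_probE probability_le1//; exact: measurable_A_set.
Qed.

Lemma support_prob_le x y :
  {ae P, forall w, A_set x w -> A_set y w} -> support_prob x <= support_prob y.
Proof.
move=> h; rewrite -lee_fin -!support_probE.
by apply: le_probability_ae => //; exact: measurable_A_set.
Qed.

(** The multiplier is the pointwise inverse of the norm; since inverse of zero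
    is zero, it kills whatever lies off the support of [x]. It is written as a
    power so that it is measurable even where a representative of the norm is
    negative. *)
Lemma norm_inv_multiplier x : exists a : L0 P k, forall v : E,
  {ae P, forall w,
    rv (rn_norm (a *: v)) w = (rv (rn_norm x) w)^-1 * rv (rn_norm v) w}.
Proof.
pose f w : R := (rv (rn_norm x) w) `^ (-1).
have mf : measurable_fun setT f.
  exact: (measurableT_comp (measurable_powR (-1)) (measurable_rv (rn_norm x))).
exists (real_L0 k mf) => v.
have h0 := rv_norm_ge0 x; have hM := rv_normM mf v; near=> w.
have x0 : 0 <= rv (rn_norm x) w by near: w; exact: h0.
have -> : rv (rn_norm (real_L0 k mf *: v)) w = `|f w| * rv (rn_norm v) w.
  by near: w; exact: hM.
by rewrite /f powR_inv1// ger0_norm// invr_ge0.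
Unshelve. all: by end_near. Qed.

Lemma normalize_on x (D : set T) : measurable D -> exists y, {ae P, forall w,
  rv (rn_norm y) w = if w \in D `&` A_set x then 1 else 0}.
Proof.
move=> mD; have [a ha] := norm_inv_multiplier x.
exists (real_L0 k (measurable_indic mD) *: (a *: x)).
have hD := rv_normM (measurable_indic mD) (a *: x); have {}ha := ha x; near=> w.
have -> : rv (rn_norm (real_L0 k (measurable_indic mD) *: (a *: x))) w =
    `|\1_D w| * rv (rn_norm (a *: x)) w by near: w; exact: hD.
have -> : rv (rn_norm (a *: x)) w = (rv (rn_norm x) w)^-1 * rv (rn_norm x) w.
  by near: w; exact: ha.
rewrite indicE in_setI; case: (w \in D) => /=; last by rewrite normr0 mul0r.
rewrite normr1 mul1r; have [/set_mem wx|] := boolP (w \in A_set x).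
  by rewrite mulVf.
by rewrite notin_setE /A_set /L0_supp /= => /negP/negPn/eqP ->; rewrite mulr0.
Unshelve. all: by end_near. Qed.

Lemma glue x y : exists z, {ae P, forall w,
  if w \in A_set x then rv (rn_norm z) w = rv (rn_norm x) w /\
                        rv (rn_norm (z - x)) w = 0
  else rv (rn_norm z) w = rv (rn_norm y) w}.
Proof.
have mA := measurableC (measurable_A_set x).
pose y' := real_L0 k (measurable_indic mA) *: y.
have hy' := rv_normM (measurable_indic mA) y.
have hx := rv_normD_off x y'; have h' := rv_normD_off y' x.
exists (x + y'); near=> w.
have y'E : rv (rn_norm y') w = `|\1_(~` A_set x) w| * rv (rn_norm y) w.
  by near: w; exact: hy'.
case: ifPn => wx.
  have y'0 : rv (rn_norm y') w = 0.
    by rewrite y'E indicE in_setC wx normr0 mul0r.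
  rewrite addrAC subrr add0r; split => //.
  by move: y'0; near: w; exact: hx.
have {}y'E : rv (rn_norm y') w = rv (rn_norm y) w.
  by rewrite y'E indicE in_setC wx normr1 mul1r.
have x0 : rv (rn_norm x) w = 0.
  by move: wx; rewrite notin_setE => /negP/negPn/eqP.
by rewrite -y'E addrC; move: x0; near: w; exact: h'.
Unshelve. all: by end_near. Qed.

Lemma glue_zero_one x y : zero_one_norm x -> zero_one_norm y ->
  exists z, [/\ zero_one_norm z,
    {ae P, forall w, A_set x w -> A_set z w},
    {ae P, forall w, A_set y w -> A_set z w} &
    {ae P, forall w, A_set x w -> rv (rn_norm (z - x)) w = 0}].
Proof.
move=> ux uy; have [z hz] := glue x y; exists z; split.
- near=> w; have : rv (rn_norm x) w = 0 \/ rv (rn_norm x) w = 1.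
    by near: w; exact: ux.
  have : rv (rn_norm y) w = 0 \/ rv (rn_norm y) w = 1 by near: w; exact: uy.
  have : if w \in A_set x then rv (rn_norm z) w = rv (rn_norm x) w /\
      rv (rn_norm (z - x)) w = 0 else rv (rn_norm z) w = rv (rn_norm y) w.
    by near: w; exact: hz.
  by case: ifPn => _ => [[->]|->].
- apply: filterS hz => w + wx; rewrite (mem_set wx) => -[e _].
  by rewrite /A_set /L0_supp /= e.
- apply: filterS hz => w; rewrite /A_set /L0_supp /=.
  by case: ifPn => [/set_mem + [-> _] //|_ -> //].
- by apply: filterS hz => w + wx; rewrite (mem_set wx) => -[].
Unshelve. all: by end_near. Qed.

Lemma zero_one_norm0 : zero_one_norm 0.
Proof.
have /rv_norm_eq0 : (0 : E) = 0 by [].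
by apply: filterS => w ->; left.
Qed.

(** If every norm vanished on [D], then the essential supremum, cut off to zero
    on [D], would still be an upper bound; minimality would force it to vanish
    on [D]. *)
Lemma full_support_meets (D : set T) : full_support E -> measurable D ->
  (0 < P D)%E -> exists x, (0 < P (A_set x `&` D))%E.
Proof.
move=> [g [[mg gub glub] g0]] mD PD; apply: contrapT => /forallNP hD.
have mC : measurable (~` D) by exact: measurableC.
have zeroD x : {ae P, forall w, D w -> rv (rn_norm x) w = 0}.
  have mAD : measurable (A_set x `&` D).
    by apply: measurableI => //; exact: measurable_A_set.
  have : P (A_set x `&` D) = 0%E.
    by apply/eqP; move/negP: (hD x); rewrite -leNgt measure_le0.
  move=> /(ae_not_null _ mAD).
  apply: filterS => w + Dw => /not_andP[]// /negP.
  by rewrite negbK => /eqP.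
have gh : {ae P, forall w, (g w <= (g \_ (~` D)) w)%E}.
  apply: glub; first by apply/(measurable_restrictT _ mC); exact: measurable_funTS.
  move=> _ [x _ <-]; have hx := gub (rn_norm x) (imageT _ x).
  have h0 := zeroD x; near=> w; rewrite patchE; case: ifPn => wD.
    by near: w; exact: hx.
  have -> : rv (rn_norm x) w = 0; last by [].
  have : D w by move: wD; rewrite notin_setE => /contrapT.
  by near: w; exact: h0.
have g_ge0 := gub (rn_norm (0 : E)) (imageT _ (0 : E)).
have /rv_norm_eq0 n0 : (0 : E) = 0 by [].
suff : P D = 0%E by move=> PD0; rewrite PD0 ltxx in PD.
apply/(ae_not_null _ mD); near=> w => Dw.
have gw0 : g w != 0%E by near: w; exact: g0.
have gw1 : (g w <= (g \_ (~` D)) w)%E by near: w; exact: gh.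
have gw2 : ((rv (rn_norm (0 : E)) w)%:E <= g w)%E by near: w; exact: g_ge0.
have n0w : rv (rn_norm (0 : E)) w = 0 by near: w; exact: n0.
rewrite n0w in gw2; move: gw0; rewrite eq_le gw2 andbT => /negP; apply.
apply: (le_trans gw1); rewrite patchE ifF// in_setC mem_set//.
Unshelve. all: by end_near. Qed.

Lemma measurable_norm_lt x (e : R) : measurable [set w | rv (rn_norm x) w < e].
Proof.
rewrite (_ : [set w | _] = rv (rn_norm x) @^-1` [set` `]-oo, e[]); last first.
  by apply/seteqP; split=> w /=; rewrite in_itv.
by rewrite -[X in measurable X]setTI; apply: measurable_rv.
Qed.

(** The basic entourage of the topology of convergence in probability. *)
Definition closer (e l : R) x y :=
  (1 - l%:E < P [set w | (rv (rn_norm (x - y)) w < e)%R])%E.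

Lemma closerC e l x y : closer e l x y -> closer e l y x.
Proof.
move=> h; apply: (lt_le_trans h); apply: le_probability_ae;
  [exact: measurable_norm_lt..|].
by rewrite -(opprB y x); apply: filterS (rv_normN (y - x)) => w /= ->.
Qed.

Lemma eps_lambda_cauchy (u : nat -> E) :
  (forall e l : R, 0 < e -> 0 < l -> exists N, forall n m, (N <= n)%N ->
    closer e l (u (n + m)%N) (u n)) ->
  cauchy ((u : nat -> eps_lambda E) @ \oo).
Proof.
move=> hu A [e [l [e0 l0 hA]]]; have [N hN] := hu e l e0 l0.
exists (u @` [set n | (N <= n)%N], u @` [set n | (N <= n)%N]) => /=.
  by split; exists N => // n Nn; exists n.
move=> [_ _] [/= [n /= Nn <-] [m /= Nm <-]]; apply: hA => /=.
have [nm|/ltnW mn] := leqP n m.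
  by apply: closerC; rewrite -(subnKC nm); exact: hN.
by rewrite -(subnKC mn); exact: hN.
Qed.

Lemma eps_lambda_cvg (F : set_system (eps_lambda E)) (x : E) (e l : R) :
  F --> (x : eps_lambda E) -> 0 < e -> 0 < l -> F [set y | closer e l x y].
Proof.
move=> Fx e0 l0; apply: Fx; apply/nbhsP.
exists [set xy : eps_lambda E * eps_lambda E | closer e l xy.1 xy.2].
  by exists e, l; split.
by move=> y /xsectionP.
Qed.

(** An exhaustion: glue vectors whose supports approach the supremum of the
    probabilities, in such a way that the supports increase and each vector
    extends the previous one. Two terms then differ only on the difference of
    their supports, whose probability tends to zero, so the sequence is Cauchy
    in probability; its limit has norm one on every one of the supports. *)
Lemma exists_max_support : complete_uniform (eps_lambda E) ->
  exists x, zero_one_norm x /\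
    forall y, zero_one_norm y -> support_prob y <= support_prob x.
Proof.
move=> Ec.
pose S : set R := [set support_prob x | x in [set x : E | zero_one_norm x]].
have S0 : S !=set0 by exists (support_prob (0 : E)), 0 => //; exact: zero_one_norm0.
have ubS : has_ubound S by exists 1 => _ [x _ <-]; exact: support_prob_le1.
have leS x : zero_one_norm x -> support_prob x <= sup S.
  by move=> ux; apply: ub_le_sup => //; exists x.
(* Improve [x] to a vector extending it, with almost maximal support. *)
have /choice[f hf] : forall nx : nat * E, exists z, zero_one_norm nx.2 ->
    [/\ zero_one_norm z,
        {ae P, forall w, A_set nx.2 w -> A_set z w},
        {ae P, forall w, A_set nx.2 w -> rv (rn_norm (z - nx.2)) w = 0} &
        sup S - nx.1.+1%:R^-1 < support_prob z].
  move=> [n x] /=; have [ux|nux] := pselect (zero_one_norm x); last by exists x.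
  have n0 : 0 < n.+1%:R^-1 :> R by rewrite invr_gt0.
  have [_ [y uy <-] hy] := sup_adherent n0 (conj S0 ubS).
  have [z [uz xz yz zx]] := glue_zero_one ux uy.
  exists z => _; split => //; apply: (lt_le_trans hy).
  exact: support_prob_le.
pose u : nat -> E := fix u n := if n is m.+1 then f (m, u m) else 0.
have u01 n : zero_one_norm (u n).
  elim: n => [|n IH] /=; first exact: zero_one_norm0.
  by have [] := hf (n, u n) IH.
have ustep n : {ae P, forall w, A_set (u n) w -> A_set (u n.+1) w /\
    rv (rn_norm (u n.+1 - u n)) w = 0}.
  have [_ h1 h2 _] := hf (n, u n) (u01 n); near=> w => uw.
  by split; move: uw; near: w; [exact: h1|exact: h2].
have usup n : sup S - n.+1%:R^-1 < support_prob (u n.+1).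
  by have [] := hf (n, u n) (u01 n).
have umono n m : {ae P, forall w, A_set (u n) w -> A_set (u (n + m)%N) w /\
    rv (rn_norm (u (n + m)%N - u n)) w = 0}.
  elim: m => [|m IH].
    rewrite addn0 subrr; have /rv_norm_eq0 : (0 : E) = 0 by [].
    by apply: filterS => w.
  have tri := rv_norm_triangle (u (n + m.+1)%N - u (n + m)%N) (u (n + m)%N - u n).
  rewrite addrA subrK in tri; have h0 := rv_norm_ge0 (u (n + m.+1)%N - u n).
  have hs := ustep (n + m)%N; rewrite -addnS in hs.
  near=> w => uw.
  have [u1 e1] : A_set (u (n + m)%N) w /\ rv (rn_norm (u (n + m)%N - u n)) w = 0.
    by move: uw; near: w; exact: IH.
  have [u2 e2] : A_set (u (n + m.+1)%N) w /\
      rv (rn_norm (u (n + m.+1)%N - u (n + m)%N)) w = 0.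
    by move: u1; near: w; exact: hs.
  split => //; apply/eqP; rewrite eq_le; apply/andP; split.
    rewrite -[leRHS]addr0 -[X in _ <= X + _]e2 -[X in _ <= _ + X]e1.
    by near: w; exact: tri.
  by near: w; exact: h0.
have uclose n m (e l : R) : 0 < e -> sup S - support_prob (u n) < l ->
    closer e l (u (n + m)%N) (u n).
  move=> e0 hl; set A := A_set (u n); set B := A_set (u (n + m)%N).
  have mA : measurable A by exact: measurable_A_set.
  have mB : measurable B by exact: measurable_A_set.
  have mBA : measurable (B `\` A) by exact: measurableD.
  have PAB : (P A <= P (B `&` A))%E.
    apply: le_probability_ae => //; first exact: measurableI.
    by apply: filterS (umono n m) => w h uw; have [] := h uw.
  have PBA : (P (B `\` A) < l%:E)%E.
    have PBE : P B = (P (B `\` A) + P (B `&` A))%E by exact: measureDI.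
    move: PBE; have := leS _ (u01 (n + m)%N).
    move: PAB; rewrite -/A -/B !support_probE.
    have PE C : measurable C -> exists p : R, P C = p%:E.
      by move=> mC; exists (fine (P C)); rewrite fineK// fin_num_measure.
    have [p ->] := PE _ mBA; have [q ->] := PE _ (measurableI _ _ mB mA).
    by rewrite -EFinD lte_fin lee_fin => qA uS [] uE; lra.
  apply: (@lt_le_trans _ _ (P (~` (B `\` A)))).
    rewrite probability_setC//; move: PBA.
    have -> : P (B `\` A) = (fine (P (B `\` A)))%:E.
      by rewrite fineK// fin_num_measure.
    by rewrite lte_fin -!EFinB lte_fin => ?; rewrite ltrD2l ltrN2.
  apply: le_probability_ae; [exact: measurableC|exact: measurable_norm_lt|].
  have h := umono n m; have tri := rv_normB (u (n + m)%N) (u n).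
  near=> w => /not_andP nBA /=.
  have [wA|wA] := pselect (A w).
    have [_ ->//] : B w /\ rv (rn_norm (u (n + m)%N - u n)) w = 0.
    by move: wA; near: w; exact: h.
  have zero (v : E) : ~ A_set v w -> rv (rn_norm v) w = 0 by move/negP/negPn/eqP.
  apply: (@le_lt_trans _ _ (rv (rn_norm (u (n + m)%N)) w + rv (rn_norm (u n)) w)).
    by near: w; exact: tri.
  by rewrite (zero _ wA) (zero (u (n + m)%N)) ?addr0//; case: nBA => // /contrapT.
have ucauchy : cauchy ((u : nat -> eps_lambda E) @ \oo).
  apply: eps_lambda_cauchy => e l e0 l0.
  near \oo => N; exists N.+1 => n m Nn; apply: uclose => //.
  have : N.+1%:R^-1 < l by near: N; exact: (near_infty_natSinv_lt (PosNum l0)).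
  have : support_prob (u N.+1) <= support_prob (u n).
    rewrite -(subnKC Nn); apply: support_prob_le.
    by apply: filterS (umono N.+1 (n - N.+1)%N) => w h uw; have [] := h uw.
  by have := usup N; move: (N.+1%:R^-1 : R) => r; lra.
have [x ux] := Ec _ _ ucauchy.
have x1 n : {ae P, forall w, A_set (u n) w -> rv (rn_norm x) w = 1}.
  have mx i : measurable [set w | i.+1%:R^-1 <= `|rv (rn_norm x) w - 1|].
    rewrite (_ : [set w | _] =
      (fun w => `|rv (rn_norm x) w - 1|) @^-1` [set` `[i.+1%:R^-1, +oo[]); last first.
      by apply/seteqP; split=> w /=; rewrite in_itv /= andbT.
    rewrite -[X in measurable X]setTI.
    have mf : measurable_fun setT (fun w => `|rv (rn_norm x) w - 1|).
      apply: (measurableT_comp (@normr_measurable R setT)).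
      by apply: measurable_funB => //; exact: measurable_rv.
    exact: mf.
  (* Where [u n] has norm one, so does every later [u m]; a limit whose norm is
     away from one there would be far from [u m] on the same set. *)
  have null i : {ae P, forall w, ~ (A_set (u n) `&`
      [set w | i.+1%:R^-1 <= `|rv (rn_norm x) w - 1|]) w}.
    set D := _ `&` _.
    have mD : measurable D by apply: measurableI => //; exact: measurable_A_set.
    apply/(ae_not_null _ mD); apply/eqP; rewrite -measure_le0; apply/lee_addgt0Pr.
    move=> l l0; rewrite add0e.
    have i0 : 0 < i.+1%:R^-1 :> R by rewrite invr_gt0.
    have [N _ hN] := eps_lambda_cvg ux i0 l0.
    have {hN} := hN (n + N)%N (leq_addl _ _); rewrite /= /closer.
    set G := [set w | _] => hG.
    have mG : measurable G by exact: measurable_norm_lt.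
    apply: (@le_trans _ _ (P (~` G))).
      apply: le_probability_ae; [by []|exact: measurableC|].
      have h := umono n N; have h1 := u01 (n + N)%N.
      have dist := rv_norm_dist x (u (n + N)%N).
      near=> w => -[wu wx] /= wG.
      have [uw _] : A_set (u (n + N)%N) w /\ rv (rn_norm (u (n + N)%N - u n)) w = 0.
        by move: wu; near: w; exact: h.
      have u1 : rv (rn_norm (u (n + N)%N)) w = 1.
        have [w0|//] : rv (rn_norm (u (n + N)%N)) w = 0 \/
            rv (rn_norm (u (n + N)%N)) w = 1.
          by near: w; exact: h1.
        by move: uw; rewrite /A_set /L0_supp /= w0 eqxx.
      have dw : `|rv (rn_norm x) w - 1| <= rv (rn_norm (x - u (n + N)%N)) w.
        by rewrite -u1; near: w; exact: dist.
      by have := le_lt_trans wx (le_lt_trans dw wG); rewrite ltxx.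
    rewrite probability_setC//; move: hG.
    have -> : P G = (fine (P G))%:E by rewrite fineK// fin_num_measure.
    by rewrite -!EFinB lte_fin lee_fin => ?; lra.
  have /ae_foralln nulls := null; apply: filterS nulls => w h uw.
  apply: contrapT => /eqP xw.
  have x0 : 0 < `|rv (rn_norm x) w - 1| by rewrite normr_gt0 subr_eq0.
  near \oo => i; apply: (h i); split => //=; apply: ltW.
  by near: i; exact: (near_infty_natSinv_lt (PosNum x0)).
have mU : measurable [set w | rv (rn_norm x) w = 1].
  have -> : [set w | rv (rn_norm x) w = 1] = rv (rn_norm x) @^-1` [set 1] by [].
  by rewrite -[X in measurable X]setTI; apply: measurable_rv.
(* The limit may be nonzero outside the union of the supports; cutting it down
   to the set where its norm is one returns to the class. *)
have [z hz] := normalize_on x mU; exists z; split.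
  by apply: filterS hz => w ->; case: ifP; [right|left].
move=> y uy; apply: le_trans (leS y uy) _; apply/ler_addgt0Pr => e e0.
near \oo => N.
have : N.+1%:R^-1 < e by near: N; exact: (near_infty_natSinv_lt (PosNum e0)).
have : support_prob (u N.+1) <= support_prob z.
  apply: support_prob_le; have h := x1 N.+1; near=> w => uw.
  have xw : rv (rn_norm x) w = 1 by move: uw; near: w; exact: h.
  have zE : rv (rn_norm z) w =
      if w \in [set w | rv (rn_norm x) w = 1] `&` A_set x then 1 else 0.
    by near: w; exact: hz.
  have wA : w \in [set w | rv (rn_norm x) w = 1] `&` A_set x.
    by rewrite inE /A_set /L0_supp /= xw oner_eq0.
  by rewrite /A_set /L0_supp /= zE wA oner_eq0.
by have := usup N; move: (N.+1%:R^-1 : R) => r; lra.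
Unshelve. all: by end_near. Qed.

(** A vector of maximal support has full support, since otherwise full support of
    the module provides a vector to glue on the missing part. *)
Lemma exists_unit_norm : complete_uniform (eps_lambda E) -> full_support E ->
  exists x, {ae P, forall w, rv (rn_norm x) w = 1}.
Proof.
move=> /exists_max_support[x [ux maxx]] Ef; exists x.
have mA := measurable_A_set x; have mC := measurableC mA.
have [C0|Cpos] := eqVneq (P (~` A_set x)) 0%E.
  move/(ae_not_null _ mC) : C0 => h; near=> w.
  have wA : A_set x w by apply: contrapT; near: w; exact: h.
  have [x0|//] : rv (rn_norm x) w = 0 \/ rv (rn_norm x) w = 1 by near: w; exact: ux.
  by move: wA; rewrite /A_set /L0_supp /= x0 eqxx.
exfalso; have {}Cpos : (0 < P (~` A_set x))%E by rewrite lt0e Cpos /=.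
have [v Pv] := full_support_meets Ef mC Cpos.
have [v' hv'] := normalize_on v mC.
have uv' : zero_one_norm v'.
  by apply: filterS hv' => w ->; case: ifP; [right|left].
have [z [uz xz vz _]] := glue_zero_one ux uv'.
have mV : measurable (A_set v `&` ~` A_set x).
  by apply: measurableI => //; exact: measurable_A_set.
have : (P (A_set x `|` (A_set v `&` ~` A_set x)) <= P (A_set z))%E.
  apply: le_probability_ae; [exact: measurableU|exact: measurable_A_set|].
  near=> w => -[wx|wv]; first by move: wx; near: w; exact: xz.
  have : A_set v' w; last by near: w; exact: vz.
  have v'E : rv (rn_norm v') w = if w \in ~` A_set x `&` A_set v then 1 else 0.
    by near: w; exact: hv'.
  by rewrite /A_set /L0_supp /= v'E setIC (mem_set wv) oner_eq0.
have -> : P (A_set x `|` (A_set v `&` ~` A_set x)) =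
    (P (A_set x) + P (A_set v `&` ~` A_set x))%E.
  by rewrite measureU// setICA setICr setI0.
move: Pv; have -> : P (A_set v `&` ~` A_set x) =
    (fine (P (A_set v `&` ~` A_set x)))%:E.
  by rewrite fineK// fin_num_measure.
rewrite !support_probE -EFinD lte_fin lee_fin.
by have := maxx z uz; lra.
Unshelve. all: by end_near. Qed.

End exhaustion.

(** * Young functions and their conjugates *)

Section star_shaped.
Context (R : realType).
Implicit Types F Phi : R -> \bar R.

(** A Young function has this property and so has its conjugate, whose values may
    be infinite: one notion gives monotonicity, measurability and the theory of
    the Luxemburg norm for both. *)
Definition star_shaped F : Prop :=
  (forall t, 0 <= t -> (0 <= F t)%E) /\
  (forall a t : R, 0 <= a <= 1 -> 0 <= t -> (F (a * t)%R <= a%:E * F t)%E).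

Lemma star_shaped_le F s t : star_shaped F -> 0 <= s -> s <= t -> (F s <= F t)%E.
Proof.
move=> [F0 Fa] s0 st; have t0 : 0 <= t by exact: le_trans st.
have [t00|tn0] := eqVneq t 0.
  by have -> : s = t by apply/eqP; rewrite eq_le st t00.
have tp : 0 < t by rewrite lt_neqAle eq_sym tn0.
have a1 : 0 <= s / t <= 1 by rewrite divr_ge0//= ler_pdivrMr// mul1r.
have := Fa (s / t) t a1 t0; rewrite divfK// => /le_trans; apply.
by rewrite -[leRHS]mul1e lee_wpmul2r// ?F0// lee_fin; case/andP: a1.
Qed.

Lemma star_shaped0 F : star_shaped F -> F 0 = 0%E.
Proof.
move=> [F0 Fa]; apply/eqP; rewrite eq_le F0// andbT.
by have := Fa 0 0; rewrite mul0r mul0e; apply; rewrite // lexx ler01.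
Qed.

(** Only the values at nonnegative arguments count, where the function is
    monotone; extended by its value at zero, it is monotone on the line. *)
Lemma star_shaped_measurable F d (T : measurableType d) (f : T -> R) :
  star_shaped F -> measurable_fun setT f ->
  measurable_fun setT (fun w => F `|f w|).
Proof.
move=> Fs mf; pose G t := F (Num.max t 0).
have G_le s t : s <= t -> (G s <= G t)%E.
  move=> st; rewrite /G; apply: (star_shaped_le Fs).
    by rewrite le_max lexx orbT.
  by rewrite ge_max !le_max st lexx !orbT.
have mG : measurable_fun setT G.
  apply: (measurability _ (ErealGenCInfty.measurableE R)) => B [C [r Cr] CB].
  rewrite -CB Cr setTI; apply: is_interval_measurable.
  move=> a b /=; rewrite !in_itv /= !andbT => Gs Gt u /andP[su ut].
  by rewrite in_itv /= andbT (le_trans Gs)// G_le.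
have -> : (fun w => F `|f w|) = G \o (fun w => `|f w|).
  by apply/funext => w; rewrite /G /= max_l.
apply: measurableT_comp => //.
exact: (measurableT_comp (@normr_measurable R setT)).
Qed.

Lemma young_star_shaped Phi : young_function Phi -> star_shaped Phi.
Proof.
move=> [P0 Pc _ [P00 _] _]; split => // a t a01 t0.
by have := Pc t 0 a t0 (lexx _) a01; rewrite mulr0 addr0 P00 mule0 adde0.
Qed.

Lemma conjugate_star_shaped Phi :
  star_shaped Phi -> star_shaped (conjugate Phi).
Proof.
move=> Ps; have [P0 Pa] := Ps; split => [s s0|a s a01 s0].
  apply: ereal_sup_ubound; exists 0 => //=.
  by rewrite mul0r (star_shaped0 Ps) oppe0 adde0.
apply: ge_ereal_sup => _ [t /= t0 <-].
have a0 : 0 <= a by case/andP: a01.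
have a1 : a <= 1 by case/andP: a01.
apply: (@le_trans _ _ (a%:E * ((t * s)%:E - Phi t))%E); last first.
  by apply: lee_wpmul2l; rewrite ?lee_fin//; apply: ereal_sup_ubound; exists t.
have := P0 t t0; case: (Phi t) => [p|_|//]; last by rewrite addeNy leNye.
rewrite lee_fin => p0; rewrite -!EFinB -EFinM lee_fin mulrBr mulrCA lerD2l lerN2.
exact: ler_piMl.
Qed.

Lemma young_inequality Phi s t : real_valued Phi -> 0 <= t ->
  ((t * s)%:E <= Phi t + conjugate Phi s)%E.
Proof.
move=> Pr t0; rewrite -leeBlDl ?Pr//.
by apply: ereal_sup_ubound; exists t.
Qed.

Lemma young_unbounded Phi (K : R) : young_function Phi ->
  exists2 t, 0 < t & (K%:E <= Phi t)%E.
Proof.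
move=> [_ _ _ _ /cvgeyPge/(_ K) hK].
near (pinfty_nbhs R) => t; exists t; first by near: t; exact: nbhs_pinfty_gt.
by near: t.
Unshelve. all: by end_near. Qed.

(** The slope is the inverse of a point where the Young function is at least one:
    beyond that point the function dominates the line, before it the line is at
    most one. *)
Lemma conjugate_le1 Phi : young_function Phi ->
  exists2 s, 0 < s & (conjugate Phi s <= 1)%E.
Proof.
move=> yP; have [t0 t00 Pt0] := young_unbounded 1 yP.
have [P0 Pa] := young_star_shaped yP; exists t0^-1; first by rewrite invr_gt0.
apply: ge_ereal_sup => _ [t /= tp <-]; have := P0 t tp.
have [tt0|tt0] := leP t t0.
  case E : (Phi t) => [p|//|//]; last by rewrite addeNy leNye.
  rewrite lee_fin -EFinB lee_fin => p0.
  have : t / t0 <= 1 by rewrite ler_pdivrMr// mul1r.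
  by move: p0; lra.
have tpos : 0 < t by exact: lt_trans tt0.
have := Pa (t0 / t) t; rewrite divfK ?gt_eqF// => /(_ _ tp).
rewrite divr_ge0 ?(ltW t00)//= ler_pdivrMr// mul1r (ltW tt0) => /(_ isT).
move=> /(le_trans Pt0); case E : (Phi t) => [p|//|//]; last by rewrite addeNy leNye.
rewrite -EFinM -EFinB !lee_fin mulrAC ler_pdivlMr// mul1r => tp0 p0.
have : t / t0 <= p by rewrite ler_pdivrMr// mulrC.
by lra.
Qed.

End star_shaped.

(** * Modulars, the Luxemburg norm, and lattice norms *)

Section modular.
Context (R : realType) (d : measure_display) (T : measurableType d).
Context (P : probability T R).
Implicit Types (F Phi : R -> \bar R) (xi eta zeta : L0 P RealScalars).

Definition modular F xi (c : R) : \bar R := (\int[P]_w F (c * `|rv xi w|)%R)%E.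

Lemma luxemburg_setE F xi :
  [set l : R | 0 < l /\ (\int[P]_w F (`|rv xi w| / l)%R <= 1)%E] =
  [set l : R | 0 < l /\ (modular F xi l^-1 <= 1)%E].
Proof.
apply/seteqP; split=> l /= [l0 h]; split => //; move: h; rewrite /modular;
  by under eq_integral do rewrite mulrC.
Qed.

Lemma rv_scale_norm (c : R) xi : 0 <= c -> {ae P, forall w,
  `|rv ((c : scalar R RealScalars) *: xi) w| = c * `|rv xi w|}.
Proof.
move=> c0; apply: filterS (rvZ c xi) => w ->.
by rewrite normrM (ger0_norm c0).
Qed.

Section star_shaped_modular.
Context (F : R -> \bar R) (Fs : star_shaped F).

Let F_ge0 (c : R) xi : 0 <= c -> forall w, setT w -> (0 <= F (c * `|rv xi w|)%R)%E.
Proof. by move=> c0 w _; apply: Fs.1; rewrite mulr_ge0. Qed.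

Lemma measurable_modular (c : R) xi : 0 <= c ->
  measurable_fun setT (fun w => F (c * `|rv xi w|)%R).
Proof.
move=> c0; have -> : (fun w => F (c * `|rv xi w|)) = (fun w => F `|c * rv xi w|).
  by apply/funext => w; rewrite normrM (ger0_norm c0).
apply: star_shaped_measurable => //; apply: measurable_funM => //.
exact: measurable_rv.
Qed.

Lemma modular_ge0 xi (c : R) : 0 <= c -> (0 <= modular F xi c)%E.
Proof. by move=> c0; apply: integral_ge0; exact: F_ge0. Qed.

Lemma modular_le xi zeta (a c : R) : 0 <= a -> 0 <= c ->
  {ae P, forall w, a * `|rv xi w| <= c * `|rv zeta w|} ->
  (modular F xi a <= modular F zeta c)%E.
Proof.
move=> a0 c0 h; apply: ae_ge0_le_integral => //;
  [exact: F_ge0|exact: measurable_modular|exact: F_ge0|exact: measurable_modular|].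
by apply: filterS h => w h _; apply: star_shaped_le => //; rewrite mulr_ge0.
Qed.

Lemma modular_star xi (a c : R) : 0 <= a <= 1 -> 0 <= c ->
  (modular F xi (a * c) <= a%:E * modular F xi c)%E.
Proof.
move=> a01 c0; have a0 : 0 <= a by case/andP: a01.
rewrite -ge0_integralZl ?lee_fin//;
  [|exact: measurable_modular|exact: F_ge0].
apply: ge0_le_integral => //.
- by apply: F_ge0; rewrite mulr_ge0.
- by apply: measurable_modular; rewrite mulr_ge0.
- by apply: measurable_funeM; exact: measurable_modular.
- by move=> w _; rewrite -mulrA; apply: Fs.2 => //; rewrite mulr_ge0.
Qed.

Lemma orlicz_space_solid xi zeta : {ae P, forall w, `|rv xi w| <= `|rv zeta w|} ->
  orlicz_space P F zeta -> orlicz_space P F xi.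
Proof.
move=> h [c c0 Fc]; exists c => //; apply: le_lt_trans Fc.
apply: modular_le; [exact: ltW|exact: ltW|].
by apply: filterS h => w ?; rewrite ler_pM2l.
Qed.

Lemma orlicz_space_scale xi (c : R) : 0 < c -> orlicz_space P F xi ->
  orlicz_space P F ((c : scalar R RealScalars) *: xi).
Proof.
move=> c0 [a a0 Fa]; exists (a / c); first exact: divr_gt0.
apply: le_lt_trans Fa; apply: modular_le; [by rewrite divr_ge0// ltW|exact: ltW|].
apply: filterS (rv_scale_norm xi (ltW c0)) => w ->.
by rewrite mulrA divfK// gt_eqF.
Qed.

(** If the modular at [c] equals [M], shrinking the argument by the factor [1 + M]
    brings the modular down to at most one. This keeps the infimum in the Luxemburg norm
    away from its default value on the empty set. *)
Lemma luxemburg_set_nonempty xi : orlicz_space P F xi ->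
  [set l : R | 0 < l /\ (modular F xi l^-1 <= 1)%E] !=set0.
Proof.
move=> [c c0 Fc]; have m0 := modular_ge0 xi (ltW c0).
have [M ME] : exists M, modular F xi c = M%:E.
  by exists (fine (modular F xi c)); rewrite fineK// ge0_fin_numE.
rewrite ME lee_fin in m0.
have M1 : 0 < 1 + M by rewrite ltr_pwDl.
exists ((1 + M) / c); split; first exact: divr_gt0.
rewrite invf_div mulrC.
have a01 : 0 <= (1 + M)^-1 <= 1.
  by rewrite invr_ge0 (ltW M1)/= invf_le1// lerDl.
apply: le_trans (modular_star xi a01 (ltW c0)) _.
by rewrite ME -EFinM lee_fin mulrC ler_pdivrMr// mul1r lerDr.
Qed.

Lemma luxemburg_set_lbound xi :
  has_lbound [set l : R | 0 < l /\ (modular F xi l^-1 <= 1)%E].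
Proof. by exists 0 => l [/ltW]. Qed.

Lemma luxemburg_norm_solid xi zeta :
  {ae P, forall w, `|rv xi w| <= `|rv zeta w|} ->
  orlicz_space P F zeta -> luxemburg_norm F xi <= luxemburg_norm F zeta.
Proof.
move=> h Fz; rewrite /luxemburg_norm !luxemburg_setE.
apply: lb_le_inf; first exact: luxemburg_set_nonempty.
move=> l /= [l0 hl]; apply: ge_inf; first exact: luxemburg_set_lbound.
split => //; apply: le_trans hl.
have l0' : 0 < l^-1 by rewrite invr_gt0.
apply: modular_le; [exact: ltW|exact: ltW|].
by apply: filterS h => w ?; rewrite ler_pM2l.
Qed.

Lemma luxemburg_norm_scale_le xi (c : R) : 0 < c -> orlicz_space P F xi ->
  luxemburg_norm F ((c : scalar R RealScalars) *: xi) <= c * luxemburg_norm F xi.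
Proof.
move=> c0 Fx; rewrite /luxemburg_norm !luxemburg_setE -ler_pdivrMl//.
apply: lb_le_inf; first exact: luxemburg_set_nonempty.
move=> l /= [l0 hl]; rewrite ler_pdivrMl//; apply: ge_inf.
  exact: luxemburg_set_lbound.
have cl0 : 0 < c * l by exact: mulr_gt0.
split => //; apply: le_trans hl; apply: modular_le; [by rewrite invr_ge0 ltW..|].
apply: filterS (rv_scale_norm xi (ltW c0)) => w ->.
by rewrite invfM mulrAC mulrA mulVf ?gt_eqF// mul1r mulrC.
Qed.

End star_shaped_modular.
End modular.

Section lattice_norm.
Context (R : realType) (d : measure_display) (T : measurableType d).
Context (P : probability T R).

(** The common features of the Luxemburg and the Orlicz norms from which the
    strict convexity of the induced norm is decided. Homogeneity is stated as an
    inequality, which applied to [c] and to its inverse gives equality. *)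
Record lattice_norm (S : set (L0 P RealScalars)) (N : L0 P RealScalars -> R) := {
  lattice_solid : forall xi zeta, {ae P, forall w, `|rv xi w| <= `|rv zeta w|} ->
    S zeta -> S xi;
  lattice_half : forall xi zeta, S xi -> S zeta ->
    S ((2^-1 : scalar R RealScalars) *: (xi + zeta));
  lattice_scale : forall (c : R) xi, 0 < c -> S xi ->
    S ((c : scalar R RealScalars) *: xi);
  lattice_indic : forall (D : set T) (mD : measurable D),
    S (L0_indic RealScalars mD);
  lattice_norm_solid : forall xi zeta,
    {ae P, forall w, `|rv xi w| <= `|rv zeta w|} -> S zeta -> N xi <= N zeta;
  lattice_norm_scale_le : forall (c : R) xi, 0 < c -> S xi ->
    N ((c : scalar R RealScalars) *: xi) <= c * N xi;
  lattice_norm_indic_gt0 : forall (D : set T) (mD : measurable D),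
    (0 < P D)%E -> 0 < N (L0_indic RealScalars mD)
}.

Context (Phi : R -> \bar R) (yPhi : young_function Phi) (rPhi : real_valued Phi).
Let Ps := young_star_shaped yPhi.

Lemma orlicz_space_half xi zeta : orlicz_space P Phi xi -> orlicz_space P Phi zeta ->
  orlicz_space P Phi ((2^-1 : scalar R RealScalars) *: (xi + zeta)).
Proof.
move=> [a a0 Fa] [b b0 Fb]; pose c := Num.min a b.
have c0 : 0 < c by rewrite lt_min a0.
exists c => //.
have half0 : 0 <= 2^-1 :> R by rewrite invr_ge0.
have le_half f e : 0 < e -> c <= e -> (modular Phi f e < +oo)%E ->
    (modular Phi f c < +oo)%E.
  move=> e0 ce; apply: le_lt_trans; apply: modular_le => //; [exact: ltW|exact: ltW|].
  by apply: aeW => w; exact: ler_wpM2r.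
have {}Fa : (modular Phi xi c < +oo)%E.
  by apply: le_half Fa => //; rewrite ge_min lexx.
have {}Fb : (modular Phi zeta c < +oo)%E.
  by apply: le_half Fb => //; rewrite ge_min lexx orbT.
apply: (@le_lt_trans _ _
    (2^-1%:E * modular Phi xi c + 2^-1%:E * modular Phi zeta c)%E); last first.
  by rewrite lte_add_pinfty// lte_mul_pinfty.
have mS f : measurable_fun setT (fun w => (2^-1%:E * Phi (c * `|rv f w|)%R)%E).
  by apply: measurable_funeM; apply: measurable_modular => //; exact: ltW.
have posS f w : setT w -> (0 <= 2^-1%:E * Phi (c * `|rv f w|)%R)%E.
  by move=> _; rewrite mule_ge0 ?lee_fin//; apply: Ps.1; rewrite mulr_ge0// ltW.
rewrite /modular -!ge0_integralZl ?lee_fin//; first last.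
- by move=> w _; apply: Ps.1; rewrite mulr_ge0// ltW.
- by apply: measurable_modular => //; exact: ltW.
- by move=> w _; apply: Ps.1; rewrite mulr_ge0// ltW.
- by apply: measurable_modular => //; exact: ltW.
rewrite -ge0_integralD//; [|exact: posS|exact: posS].
apply: ae_ge0_le_integral => //.
- by move=> w _; apply: Ps.1; rewrite mulr_ge0// ltW.
- by apply: measurable_modular => //; exact: ltW.
- by move=> w _; rewrite adde_ge0//; exact: posS.
- by apply: emeasurable_funD.
have hS := rv_scale_norm (xi + zeta) half0; have hD := rvD xi zeta.
near=> w => _; have -> : `|rv ((2^-1 : scalar R RealScalars) *: (xi + zeta)) w| =
    2^-1 * `|rv (xi + zeta) w| by near: w; exact: hS.
have -> : rv (xi + zeta) w = rv xi w + rv zeta w by near: w; exact: hD.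
have [_ cvx _ _ _] := yPhi.
have h01 : 0 <= (2^-1 : R) <= 1 by rewrite half0 invf_le1// ler1n.
have cpos (r : R) : 0 <= c * `|r| by rewrite mulr_ge0// ltW.
have := cvx _ _ _ (cpos (rv xi w)) (cpos (rv zeta w)) h01.
rewrite (_ : 1 - 2^-1 = 2^-1 :> R); last by lra.
apply: le_trans; apply: star_shaped_le => //; first by rewrite !mulr_ge0// ltW.
rewrite !(mulrCA _ c) -!mulrDr ler_pM2l// ler_pM2l ?invr_gt0//.
exact: ler_normD.
Unshelve. all: by end_near. Qed.

Lemma orlicz_space_indic (D : set T) (mD : measurable D) :
  orlicz_space P Phi (L0_indic RealScalars mD).
Proof.
exists 1 => //; apply: (@le_lt_trans _ _ (\int[P]_w (cst (Phi 1%R) w))%E).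
  apply: ae_ge0_le_integral => //.
  - by move=> w _; apply: Ps.1; rewrite mulr_ge0.
  - exact: measurable_modular.
  - by move=> w _; exact: Ps.1.
  - apply: filterS (rv_indic P mD) => w -> _; apply: (star_shaped_le Ps).
      by rewrite mulr_ge0.
    by rewrite mul1r indicE; case: (_ \in _); rewrite ?normr1 ?normr0.
rewrite integral_cst// [X in (_ * X)%E](_ : _ = 1%E); last exact: probability_setT.
rewrite mule1.
by have := rPhi ler01; rewrite fin_numE ltey => /andP[].
Qed.

(** If the function is at least [2 / P D] at [t], then dividing the indicator by less
    than [1 / t] makes its modular at least two. *)
Lemma luxemburg_norm_indic_gt0 (D : set T) (mD : measurable D) : (0 < P D)%E ->
  0 < luxemburg_norm Phi (L0_indic RealScalars mD : L0 P RealScalars).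
Proof.
move=> PD; have PDE : P D = (fine (P D))%:E by rewrite fineK// fin_num_measure.
have p0 : 0 < fine (P D) by rewrite -lte_fin -PDE.
have [t t0 ht] := young_unbounded (2 / fine (P D)) yPhi.
apply: (@lt_le_trans _ _ t^-1); first by rewrite invr_gt0.
rewrite /luxemburg_norm luxemburg_setE; apply: lb_le_inf.
  by apply: luxemburg_set_nonempty => //; exact: orlicz_space_indic.
move=> l /= [l0 hl]; rewrite leNgt; apply/negP => lt.
suff : (2%:E <= modular Phi (L0_indic RealScalars mD : L0 P RealScalars) l^-1)%E.
  by move=> /le_trans/(_ hl); rewrite lee_fin; lra.
have tl : t <= l^-1 by rewrite -(invrK t) lef_pV2 ?posrE ?invr_gt0// ltW.
apply: (@le_trans _ _ (\int[P]_w ((2 / fine (P D))%:E * (\1_D w)%:E))%E).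
  rewrite ge0_integralZl//; last 2 first.
  - exact/measurable_EFinP/measurable_indic.
  - by rewrite lee_fin divr_ge0// ltW.
  have -> : (\int[P]_w (\1_D w)%:E)%E = (fine (P D))%:E.
    by rewrite integral_indic// setIT; exact: PDE.
  by rewrite -EFinM divfK// gt_eqF.
apply: ae_ge0_le_integral => //.
- by move=> w _; rewrite mule_ge0// lee_fin divr_ge0// ltW.
- by apply: measurable_funeM; exact/measurable_EFinP/measurable_indic.
- by move=> w _; apply: Ps.1; rewrite mulr_ge0// invr_ge0 ltW.
- by apply: measurable_modular => //; rewrite invr_ge0 ltW.
apply: filterS (rv_indic P mD) => w -> _; rewrite indicE.
case: (w \in D) => /=; last by rewrite normr0 mulr0 mule0 (star_shaped0 Ps).
rewrite mule1 normr1 mulr1; apply: le_trans ht _.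
by apply: star_shaped_le => //; exact: ltW.
Qed.

Lemma luxemburg_lattice_norm :
  lattice_norm (orlicz_space P Phi) (@luxemburg_norm R d T P Phi).
Proof.
split.
- by move=> xi zeta; exact: (orlicz_space_solid Ps).
- exact: orlicz_space_half.
- by move=> c xi; exact: (orlicz_space_scale Ps).
- exact: orlicz_space_indic.
- by move=> xi zeta; exact: (luxemburg_norm_solid Ps).
- by move=> c xi; exact: (luxemburg_norm_scale_le Ps).
- exact: luxemburg_norm_indic_gt0.
Qed.

End lattice_norm.

(** * The Orlicz norm *)

Section orlicz.
Context (R : realType) (d : measure_display) (T : measurableType d).
Context (P : probability T R).
Context (Phi : R -> \bar R) (yPhi : young_function Phi) (rPhi : real_valued Phi).
Let Ps := young_star_shaped yPhi.
Let Cs := conjugate_star_shaped Ps.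
Implicit Types xi eta zeta : L0 P RealScalars.

Definition dual_ball : set (L0 P RealScalars) :=
  [set eta | orlicz_space P (conjugate Phi) eta /\
             luxemburg_norm (conjugate Phi) eta <= 1].

Definition pairing xi eta : R := \int[P]_w (rv xi w * rv eta w).

Definition abs_pairing xi eta : \bar R :=
  (\int[P]_w (`|rv xi w| * `|rv eta w|)%:E)%E.

Lemma orlicz_normE xi :
  orlicz_norm Phi xi = sup [set `|pairing xi eta| | eta in dual_ball].
Proof. by rewrite /orlicz_norm /pairing /Rintegral expectation.unlock. Qed.

Lemma dual_ball_solid eta eta' :
  {ae P, forall w, `|rv eta' w| <= `|rv eta w|} -> dual_ball eta -> dual_ball eta'.
Proof.
move=> h [h1 h2]; split; first exact: (orlicz_space_solid Cs h).
by apply: le_trans h2; exact: (luxemburg_norm_solid Cs h).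
Qed.

Lemma measurable_abs_rv xi : measurable_fun setT (fun w => `|rv xi w|).
Proof. exact: (measurableT_comp (@normr_measurable R setT) (measurable_rv xi)). Qed.

Lemma measurable_abs_rvM xi eta :
  measurable_fun setT (fun w => (`|rv xi w| * `|rv eta w|)%:E).
Proof.
by apply/measurable_EFinP; apply: measurable_funM; exact: measurable_abs_rv.
Qed.

Lemma measurable_rvM xi eta : measurable_fun setT (fun w => (rv xi w * rv eta w)%:E).
Proof. by apply/measurable_EFinP; apply: measurable_funM; exact: measurable_rv. Qed.

Lemma abs_pairing_le xi zeta eta : {ae P, forall w, `|rv xi w| <= `|rv zeta w|} ->
  (abs_pairing xi eta <= abs_pairing zeta eta)%E.
Proof.
move=> h; apply: ae_ge0_le_integral => //; try exact: measurable_abs_rvM.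
by apply: filterS h => w h _; rewrite lee_fin ler_wpM2r.
Qed.

Lemma pairing_le_abs xi eta : (`|pairing xi eta|%:E <= abs_pairing xi eta)%E.
Proof.
have le_fine (x : \bar R) : (`|fine x|%:E <= `|x|)%E.
  by case: x => [r||] //=; rewrite normr0 leey.
apply: (le_trans (le_fine _)).
apply: (le_trans (le_abse_integral P measurableT (measurable_rvM xi eta))).
by under eq_integral do rewrite abse_EFin normrM.
Qed.

(** Young's inequality bounds the pairing by the two modulars, the second of
    which is at most one after division by some [l < 2]. So the supremum in the
    Orlicz norm is that of a bounded set, and the products are integrable. *)
Lemma abs_pairing_bound xi : orlicz_space P Phi xi ->
  exists M : R, forall eta, dual_ball eta -> (abs_pairing xi eta <= M%:E)%E.
Proof.
move=> [c c0 Fc]; have m0 := modular_ge0 Ps xi (ltW c0).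
have [m mE] : exists m, modular Phi xi c = m%:E.
  by exists (fine (modular Phi xi c)); rewrite fineK// ge0_fin_numE.
rewrite mE lee_fin in m0.
exists (2 / c * (m + 1)) => eta [Feta]; rewrite /luxemburg_norm luxemburg_setE => le1.
have [l [l0 hl] l2] : exists2 l : R,
    0 < l /\ (modular (conjugate Phi) eta l^-1 <= 1)%E & l < 2.
  apply: inf_lt; first exact: (luxemburg_set_nonempty Cs Feta).
  by apply: le_lt_trans le1 _; rewrite ltr1n.
have il0 : 0 <= l^-1 by rewrite invr_ge0 ltW.
have lc0 : 0 <= l / c by rewrite divr_ge0// ltW.
have posP w : setT w -> (0 <= Phi (c * `|rv xi w|)%R)%E.
  by move=> _; apply: Ps.1; rewrite mulr_ge0// ltW.
have posC w : setT w -> (0 <= conjugate Phi (l^-1 * `|rv eta w|)%R)%E.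
  by move=> _; apply: Cs.1; rewrite mulr_ge0.
have mP := measurable_modular Ps xi (ltW c0).
have mC := measurable_modular Cs eta il0.
apply: (@le_trans _ _ (\int[P]_w ((l / c)%:E *
    (Phi (c * `|rv xi w|)%R + conjugate Phi (l^-1 * `|rv eta w|)%R)))%E).
  apply: ae_ge0_le_integral => //.
  - exact: measurable_abs_rvM.
  - by move=> w _; rewrite mule_ge0 ?lee_fin// adde_ge0 ?posP ?posC.
  - by apply: measurable_funeM; exact: emeasurable_funD.
  apply: aeW => w _; apply: (@le_trans _ _ ((l / c)%:E *
    ((c * `|rv xi w|) * (l^-1 * `|rv eta w|))%:E)%E).
    rewrite -EFinM lee_fin le_eqVlt; apply/orP; left; apply/eqP.
    by field; rewrite !gt_eqF.
  apply: lee_wpmul2l; first by rewrite lee_fin.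
  by apply: young_inequality => //; rewrite mulr_ge0// ltW.
rewrite ge0_integralZl//; last 2 first.
- exact: emeasurable_funD.
- by move=> w _; rewrite adde_ge0 ?posP ?posC.
rewrite ge0_integralD//.
apply: (@le_trans _ _ ((l / c)%:E * (m + 1)%:E)%E).
  by apply: lee_wpmul2l; rewrite ?lee_fin// EFinD leeD// -mE.
rewrite -EFinM lee_fin ler_wpM2r ?addr_ge0//.
by rewrite ler_pM2r ?invr_gt0// ltW.
Qed.

Lemma dual_ball0 : dual_ball 0.
Proof.
have modular0 (c : R) : 0 <= c -> modular (conjugate Phi) (0 : L0 P RealScalars) c = 0%E.
  move=> c0; apply/eqP; rewrite eq_le (modular_ge0 Cs)// andbT.
  apply: (@le_trans _ _ (\int[P]_w 0)%E); last by rewrite integral0.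
  apply: ae_ge0_le_integral => //.
  - by move=> w _; apply: Cs.1; rewrite mulr_ge0.
  - exact: (measurable_modular Cs).
  - by apply: filterS (rv0 P) => w -> _; rewrite normr0 mulr0 (star_shaped0 Cs).
split; first by exists 1 => //; rewrite -/(modular _ _ _) modular0.
rewrite /luxemburg_norm luxemburg_setE; apply: ge_inf.
  exact: luxemburg_set_lbound.
by split => //; rewrite modular0.
Qed.

Lemma orlicz_set_nonempty xi : [set `|pairing xi eta| | eta in dual_ball] !=set0.
Proof. by exists `|pairing xi 0|, 0 => //; exact: dual_ball0. Qed.

Lemma orlicz_norm_ub xi eta : orlicz_space P Phi xi -> dual_ball eta ->
  `|pairing xi eta| <= orlicz_norm Phi xi.
Proof.
move=> /abs_pairing_bound[M hM] Beta; rewrite orlicz_normE.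
apply: ub_le_sup; last by exists eta.
exists M => _ [zeta Bzeta <-].
by rewrite -lee_fin; apply: le_trans (pairing_le_abs _ _) (hM _ Bzeta).
Qed.

(** Multiplying the absolute value of the test element by the sign of [zeta] does
    not leave the dual ball, and turns the absolute pairing into a pairing.
    Monotonicity of the Orlicz norm follows. *)
Lemma abs_pairing_attained zeta eta : orlicz_space P Phi zeta -> dual_ball eta ->
  exists2 eta', dual_ball eta' & abs_pairing zeta eta = (pairing zeta eta')%:E.
Proof.
move=> Fz Beta; have [M /(_ _ Beta) hM] := abs_pairing_bound Fz.
have mneg : measurable [set w | rv zeta w < 0].
  have -> : [set w | rv zeta w < 0] = rv zeta @^-1` [set` `]-oo, 0[].
    by apply/seteqP; split=> w /=; rewrite in_itv.
  by rewrite -[X in measurable X]setTI; apply: measurable_rv.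
(* The first factor is the sign of [zeta], with value one at zero. *)
pose f w : R := (1 - 2 * \1_[set w | rv zeta w < 0] w) * `|rv eta w|.
have mf : measurable_fun setT f.
  apply: measurable_funM; last exact: measurable_abs_rv.
  apply: measurable_funB => //; apply: measurable_funM => //.
have fE := rv_real_L0 P mf.
have zf w : rv zeta w * f w = `|rv zeta w| * `|rv eta w|.
  rewrite /f indicE; case: (ltrP (rv zeta w) 0) => z0.
    by rewrite mem_set//= (ltr0_norm z0) mulrA; congr (_ * _); lra.
  rewrite memNset /=; last by apply/negP; rewrite -leNgt.
  by rewrite (ger0_norm z0) mulr0 subr0 mul1r.
exists (real_L0 RealScalars mf).
  apply: dual_ball_solid Beta; apply: filterS fE => w ->.
  rewrite /f normrM normr_id indicE; case: (_ \in _) => /=.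
    by rewrite mulr1 (_ : 1 - 2 = -1); [rewrite normrN1 mul1r|lra].
  by rewrite mulr0 subr0 normr1 mul1r.
have -> : pairing zeta (real_L0 RealScalars mf) = fine (abs_pairing zeta eta).
  rewrite /pairing /Rintegral; congr fine; apply: ae_eq_integral => //.
  - exact: measurable_rvM.
  - exact: measurable_abs_rvM.
  - by apply: filterS fE => w -> _; rewrite zf.
rewrite fineK// ge0_fin_numE; first by apply: le_lt_trans hM _; rewrite ltry.
by apply: integral_ge0 => w _; rewrite lee_fin mulr_ge0.
Qed.

Lemma orlicz_norm_solid xi zeta : {ae P, forall w, `|rv xi w| <= `|rv zeta w|} ->
  orlicz_space P Phi zeta -> orlicz_norm Phi xi <= orlicz_norm Phi zeta.
Proof.
move=> h Fz; rewrite [leLHS]orlicz_normE; apply: ge_sup.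
  exact: orlicz_set_nonempty.
move=> _ [eta Beta <-]; have [eta' Beta' E] := abs_pairing_attained Fz Beta.
apply: le_trans (orlicz_norm_ub Fz Beta'); rewrite -lee_fin.
apply: le_trans (pairing_le_abs _ _) _; apply: le_trans (abs_pairing_le _ h) _.
by rewrite E lee_fin ler_norm.
Qed.

Lemma orlicz_norm_scale_le (c : R) xi : 0 < c -> orlicz_space P Phi xi ->
  orlicz_norm Phi ((c : scalar R RealScalars) *: xi) <= c * orlicz_norm Phi xi.
Proof.
move=> c0 Fx; rewrite [leLHS]orlicz_normE; apply: ge_sup.
  exact: orlicz_set_nonempty.
move=> _ [eta Beta <-].
have -> : pairing ((c : scalar R RealScalars) *: xi) eta = c * pairing xi eta.
  rewrite /pairing -RintegralZl//; last first.
    apply/integrableP; split; first exact: measurable_rvM.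
    have [M /(_ _ Beta) hM] := abs_pairing_bound Fx.
    apply: (@le_lt_trans _ _ M%:E); last by rewrite ltry.
    apply: le_trans hM; rewrite /abs_pairing.
    by under eq_integral do rewrite /= normrM.
  rewrite /Rintegral; congr fine; apply: ae_eq_integral => //.
  - exact: measurable_rvM.
  - apply/measurable_EFinP; apply: measurable_funM => //.
    by apply: measurable_funM; exact: measurable_rv.
  - by apply: filterS (rvZ c xi) => w -> _; rewrite mulrA.
by rewrite normrM gtr0_norm// ler_pM2l//; exact: orlicz_norm_ub.
Qed.

Lemma orlicz_norm_indic_gt0 (D : set T) (mD : measurable D) : (0 < P D)%E ->
  0 < orlicz_norm Phi (L0_indic RealScalars mD : L0 P RealScalars).
Proof.
move=> PD; have PDE : P D = (fine (P D))%:E by rewrite fineK// fin_num_measure.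
have p0 : 0 < fine (P D) by rewrite -lte_fin -PDE.
have [s s0 cs1] := conjugate_le1 yPhi.
have ms : measurable_fun setT (fun w : T => s * \1_D w : R).
  by apply: measurable_funM => //; exact: measurable_indic.
have sE := rv_real_L0 P ms.
have mod1 : (modular (conjugate Phi) (real_L0 RealScalars ms : L0 P RealScalars) 1 <= 1)%E.
  apply: (@le_trans _ _ (\int[P]_w (cst 1%E w))%E); last first.
    by rewrite integral_cst// mul1e; exact: probability_le1.
  apply: ae_ge0_le_integral => //.
  - by move=> w _; apply: Cs.1; rewrite mulr_ge0.
  - exact: (measurable_modular Cs).
  - apply: filterS sE => w -> _; rewrite mul1r indicE.
    case: (_ \in _) => /=; last by rewrite mulr0 normr0 (star_shaped0 Cs).
    by rewrite mulr1 gtr0_norm.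
have Beta : dual_ball (real_L0 RealScalars ms).
  split; first by exists 1 => //; apply: le_lt_trans mod1 _; rewrite ltry.
  rewrite /luxemburg_norm luxemburg_setE; apply: ge_inf.
    exact: luxemburg_set_lbound.
  by split => //; rewrite invr1.
have FD : orlicz_space P Phi (L0_indic RealScalars mD) by exact: orlicz_space_indic.
apply: (lt_le_trans _ (orlicz_norm_ub FD Beta)).
have -> : pairing (L0_indic RealScalars mD) (real_L0 RealScalars ms) = s * fine (P D).
  transitivity (\int[P]_w (s * \1_D w)).
    rewrite /pairing /Rintegral; congr fine; apply: ae_eq_integral => //.
    - exact: measurable_rvM.
    - exact/measurable_EFinP.
    have iE := rv_indic P mD; near=> w => _.
    have -> : rv (real_L0 RealScalars ms : L0 P RealScalars) w = s * \1_D w.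
      by near: w; exact: sE.
    have -> : rv (L0_indic RealScalars mD : L0 P RealScalars) w = \1_D w.
      by near: w; exact: iE.
    by rewrite indicE; case: (_ \in _); rewrite ?mul1r ?mul0r ?mulr0.
  rewrite /Rintegral; under eq_integral do rewrite EFinM.
  rewrite ge0_integralZl//; [|exact/measurable_EFinP/measurable_indic|by rewrite lee_fin ltW].
  rewrite integral_indic// setIT [X in (_ * X)%E](_ : _ = (fine (P D))%:E)//.
by rewrite normr_gt0 mulf_neq0// gt_eqF.
Unshelve. all: by end_near. Qed.

Lemma orlicz_lattice_norm :
  lattice_norm (orlicz_space P Phi) (@orlicz_norm R d T P Phi).
Proof.
split.
- by move=> xi zeta; exact: (orlicz_space_solid Ps).
- exact: orlicz_space_half.
- by move=> c xi; exact: (orlicz_space_scale Ps).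
- exact: orlicz_space_indic.
- exact: orlicz_norm_solid.
- exact: orlicz_norm_scale_le.
- exact: orlicz_norm_indic_gt0.
Qed.

End orlicz.

(** * Strict convexity for lattice norms *)

Section strict_convexity.
Context (R : realType) (d : measure_display) (T : measurableType d).
Context (P : probability T R) (k : scalar_kind) (E : rnModType P k).
Implicit Types x y : E.

Lemma real_L0D (f g h : T -> R) (mf : measurable_fun setT f)
    (mg : measurable_fun setT g) (mh : measurable_fun setT h) :
  (forall w, h w = f w + g w) ->
  real_L0 k mh = real_L0 k mf + real_L0 k mg :> L0 P k.
Proof.
move=> hE; apply/L0_eqP; near=> w; rewrite (near (real_L0E P k mh) w)//.
rewrite (near (L0_repD (real_L0 k mf) (real_L0 k mg)) w)//.
rewrite (near (real_L0E P k mf) w)// (near (real_L0E P k mg) w)//.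
by rewrite hE real_scalarD.
Unshelve. all: by end_near. Qed.

(** Replaces the indicator of the support by a condition on the values of the
    norm. *)
Lemma random_unit_sphereP x :
  random_unit_sphere x <-> x <> 0 /\ zero_one_norm x.
Proof.
pose mA := measurable_L0_supp (rn_norm x).
have hI := rv_indic P mA; have hM := rv_normM (measurable_indic mA) x.
have suppE : {ae P, forall w, rv (rn_norm (L0_indic k mA *: x)) w = rv (rn_norm x) w}.
  rewrite L0_indicE; apply: filterS hM => w ->; rewrite indicE.
  have [wA|wA] := boolP (w \in L0_supp (rn_norm x)); first by rewrite normr1 mul1r.
  by move: wA; rewrite notin_setE => /negP/negPn/eqP ->; rewrite mulr0.
split=> -[x0 h]; split => //.
  have {}h := (rvP _ _).1 h; near=> w.
  have e1 : rv (rn_norm (L0_indic k mA *: x)) w =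
      rv (L0_indic RealScalars mA : L0 P RealScalars) w by near: w; exact: h.
  have e2 : rv (rn_norm (L0_indic k mA *: x)) w = rv (rn_norm x) w.
    by near: w; exact: suppE.
  have e3 : rv (L0_indic RealScalars mA : L0 P RealScalars) w = \1_(L0_supp (rn_norm x)) w.
    by near: w; exact: hI.
  by rewrite -e2 e1 e3 indicE; case: (_ \in _); [right|left].
apply/rvP; near=> w.
have -> : rv (rn_norm (L0_indic k mA *: x)) w = rv (rn_norm x) w.
  by near: w; exact: suppE.
have -> : rv (L0_indic RealScalars mA : L0 P RealScalars) w = \1_(L0_supp (rn_norm x)) w.
  by near: w; exact: hI.
have [w0|w1] : rv (rn_norm x) w = 0 \/ rv (rn_norm x) w = 1 by near: w; exact: h.
  by rewrite indicE memNset// /L0_supp /= w0 eqxx.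
by rewrite indicE mem_set// /L0_supp /= w1 oner_eq0.
Unshelve. all: by end_near. Qed.

Lemma rv_norm_midpoint_le x y : {ae P, forall w,
  `|rv (rn_norm ((2^-1 : scalar R k)%:A *: (x + y))) w| <=
  `|rv ((2^-1 : scalar R RealScalars) *: (rn_norm x + rn_norm y)) w|}.
Proof.
have half0 : 0 <= 2^-1 :> R by rewrite invr_ge0.
have hS := rv_scale_norm (rn_norm x + rn_norm y) half0.
have hD := rvD (rn_norm x) (rn_norm y).
have hh := rv_norm_half (x + y); have h0 := rv_norm_ge0 (x + y).
have ht := rv_norm_triangle x y; near=> w.
have -> : rv (rn_norm ((2^-1 : scalar R k)%:A *: (x + y))) w =
    2^-1 * rv (rn_norm (x + y)) w by near: w; exact: hh.
have -> : `|rv ((2^-1 : scalar R RealScalars) *: (rn_norm x + rn_norm y)) w| =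
    2^-1 * `|rv (rn_norm x + rn_norm y) w| by near: w; exact: hS.
have -> : rv (rn_norm x + rn_norm y) w = rv (rn_norm x) w + rv (rn_norm y) w.
  by near: w; exact: hD.
have xy0 : 0 <= rv (rn_norm (x + y)) w by near: w; exact: h0.
rewrite normrM (ger0_norm half0) ler_pM2l ?invr_gt0// (ger0_norm xy0).
by apply: le_trans (ler_norm _); near: w; exact: ht.
Unshelve. all: by end_near. Qed.

(** Dividing by the common norm moves [x] and [y] to the random unit sphere
    without changing where they differ; there the midpoint has norm less than
    one, so the original midpoint is shorter than [x] on a set of positive
    probability. *)
Lemma midpoint_norm_neq x y : random_strictly_convex E -> x <> y ->
  rn_norm x = rn_norm y ->
  rn_norm ((2^-1 : scalar R k)%:A *: (x + y)) <> rn_norm x.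
Proof.
move=> rsc xy nxy; set z := _ *: (x + y) => /rvP zxE.
have [a normE] := norm_inv_multiplier x.
have h0x := rv_norm_ge0 x.
have sphere (v : E) : v <> 0 -> rn_norm v = rn_norm x ->
      random_unit_sphere (a *: v).
  move=> v0 vx; have hv := normE v; rewrite vx in hv.
  apply/random_unit_sphereP; split.
    move=> /rv_norm_eq0 fv0; apply: v0; apply/rv_norm_eq0; rewrite vx.
    near=> w; apply/eqP.
    have : rv (rn_norm (a *: v)) w = 0 by near: w; exact: fv0.
    have -> : rv (rn_norm (a *: v)) w = (rv (rn_norm x) w)^-1 * rv (rn_norm x) w.
      by near: w; exact: hv.
    by move=> /eqP; rewrite mulf_eq0 invr_eq0 orbb.
  apply: filterS hv => w ->.
  have [->|w0] := eqVneq (rv (rn_norm x) w) 0; first by left; rewrite mulr0.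
  by right; rewrite mulVf.
have xyN0 : x - y <> 0 by move=> /eqP; rewrite subr_eq0 => /eqP.
have x0 : x <> 0.
  move=> x0; apply: xy; have /rn_norm_eq0 := x0; rewrite nxy => /rn_norm_eq0 y0.
  by rewrite x0 y0.
have y0 : y <> 0.
  by move=> y0; have /rn_norm_eq0 := y0; rewrite -nxy => /rn_norm_eq0.
have sx := sphere _ x0 erefl; have sy := sphere _ y0 (esym nxy).
set x' := a *: x in sx; set y' := a *: y in sy.
have mB : measurable (B_set x' y').
  by do 2?apply: measurableI; exact: measurable_A_set.
have hx := normE x; have hy := normE y; have hxy := normE (x - y).
have xyle := rv_normB x y; have hxy0 := rv_norm_ge0 (x - y).
rewrite -nxy in hy xyle.
have Bsupp : {ae P, forall w, rv (rn_norm (x - y)) w != 0 -> B_set x' y' w}.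
  near=> w => xyw.
  have xyw0 : 0 <= rv (rn_norm (x - y)) w by near: w; exact: hxy0.
  have tri : rv (rn_norm (x - y)) w <= rv (rn_norm x) w + rv (rn_norm x) w.
    by near: w; exact: xyle.
  have xw : rv (rn_norm x) w != 0.
    apply/eqP => xw; move/eqP: xyw; apply; apply/eqP; rewrite eq_le xyw0 andbT.
    by move: tri; rewrite xw addr0.
  split; first split; rewrite /A_set /L0_supp /=.
  - have -> : rv (rn_norm x') w = (rv (rn_norm x) w)^-1 * rv (rn_norm x) w.
      by near: w; exact: hx.
    by rewrite mulVf// oner_eq0.
  - have -> : rv (rn_norm y') w = (rv (rn_norm x) w)^-1 * rv (rn_norm x) w.
      by near: w; exact: hy.
    by rewrite mulVf// oner_eq0.
  - rewrite -scalerBr.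
    have -> : rv (rn_norm (a *: (x - y))) w =
        (rv (rn_norm x) w)^-1 * rv (rn_norm (x - y)) w by near: w; exact: hxy.
    by rewrite mulf_neq0// invr_eq0.
have PB : (0 < P (B_set x' y'))%E.
  rewrite lt0e measure_ge0 andbT; apply/eqP => /(ae_not_null _ mB) nB.
  apply: xyN0; apply/rv_norm_eq0; near=> w; apply/eqP/negPn/negP => xyw.
  have : B_set x' y' w by move: xyw; near: w; exact: Bsupp.
  by near: w; exact: nB.
have lt1 := rsc _ _ sx sy PB; have hz := normE z.
have zE : (2^-1 : scalar R k)%:A *: (x' + y') = a *: z.
  by rewrite /x' /y' /z -scalerDr !scalerA mulrC.
rewrite zE in lt1.
move: PB; apply/negP; rewrite -leNgt measure_le0; apply/eqP/(ae_not_null _ mB).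
near=> w => Bw.
have zw : rv (rn_norm (a *: z)) w < 1 by move: Bw; near: w; exact: lt1.
have zE' : rv (rn_norm (a *: z)) w = (rv (rn_norm x) w)^-1 * rv (rn_norm z) w.
  by near: w; exact: hz.
have zxw : rv (rn_norm z) w = rv (rn_norm x) w by near: w; exact: zxE.
have xE' : rv (rn_norm x') w = (rv (rn_norm x) w)^-1 * rv (rn_norm x) w.
  by near: w; exact: hx.
have xw : rv (rn_norm x) w != 0.
  by apply/eqP => xw; have := Bw.1.1; rewrite /A_set /L0_supp /= xE' xw mulr0 eqxx.
by move: zw; rewrite zE' zxw mulVf// ltxx.
Unshelve. all: by end_near. Qed.

Context (S : set (L0 P RealScalars)) (N : L0 P RealScalars -> R).
Context (LN : lattice_norm S N).

Lemma lattice_norm_abs xi zeta :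
  {ae P, forall w, `|rv xi w| = `|rv zeta w|} -> S zeta -> N xi = N zeta.
Proof.
move=> h Sz; have le1 : {ae P, forall w, `|rv xi w| <= `|rv zeta w|}.
  by apply: filterS h => w ->.
have le2 : {ae P, forall w, `|rv zeta w| <= `|rv xi w|}.
  by apply: filterS h => w ->.
have Sx := lattice_solid LN le1 Sz.
by apply/eqP; rewrite eq_le !(lattice_norm_solid LN).
Qed.

Lemma lattice_norm_scale (c : R) xi : 0 < c -> S xi ->
  N ((c : scalar R RealScalars) *: xi) = c * N xi.
Proof.
move=> c0 Sx; apply/eqP; rewrite eq_le (lattice_norm_scale_le LN)//=.
have Scx := lattice_scale LN c0 Sx.
have ic0 : 0 < c^-1 by rewrite invr_gt0.
have := lattice_norm_scale_le LN ic0 Scx.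
rewrite scalerA (_ : c^-1 * c = 1 :> scalar R RealScalars); last first.
  by rewrite mulVf// gt_eqF.
by rewrite scale1r ler_pdivlMl.
Qed.

Lemma lattice_norm_midpoint_mem x y : S (rn_norm x) -> S (rn_norm y) ->
  S (rn_norm ((2^-1 : scalar R k)%:A *: (x + y))).
Proof.
move=> Sx Sy; apply: (lattice_solid LN (rv_norm_midpoint_le x y)).
exact: (lattice_half LN).
Qed.

Let module_strictly_convex := strictly_convex
  ([set x | S (rn_norm (x : E))] : set (restrict_scalars E))
  (fun x => N (rn_norm (x : E))).

(** Multiples of a vector of norm one form an isometric copy of [S], up to absolute
    values, which the norm does not see. *)
Lemma strictly_convex_lattice (e : E) : {ae P, forall w, rv (rn_norm e) w = 1} ->
  module_strictly_convex -> strictly_convex S N.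
Proof.
move=> e1 sc xi eta Sxi Seta xieta Nxi Neta.
pose u := real_L0 k (measurable_rv xi) *: e.
pose v := real_L0 k (measurable_rv eta) *: e.
have normE f (mf : measurable_fun setT f) : {ae P, forall w,
    rv (rn_norm (real_L0 k mf *: e)) w = `|f w|}.
  have h := rv_normM mf e; near=> w.
  have -> : rv (rn_norm (real_L0 k mf *: e)) w = `|f w| * rv (rn_norm e) w.
    by near: w; exact: h.
  by rewrite (near e1 w)// mulr1.
have absE (zeta : L0 P RealScalars) : {ae P, forall w,
    `|rv (rn_norm (real_L0 k (measurable_rv zeta) *: e)) w| = `|rv zeta w|}.
  by apply: filterS (normE _ (measurable_rv zeta)) => w ->; rewrite normr_id.
have memE (zeta : L0 P RealScalars) : S zeta ->
    S (rn_norm (real_L0 k (measurable_rv zeta) *: e)).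
  by move=> Sz; apply: (lattice_solid LN) Sz; apply: filterS (absE zeta) => w ->.
have uv : u <> v.
  move=> uv; apply: xieta; apply/rvP.
  have mB : measurable_fun setT (fun w => rv xi w - rv eta w).
    by apply: measurable_funB; exact: measurable_rv.
  have /rv_norm_eq0 z : real_L0 k mB *: e = 0.
    apply: (@addrI _ v); rewrite addr0 -{2}uv -scalerDl; congr (_ *: _).
    by apply/esym/real_L0D => w; rewrite addrC subrK.
  have h := normE _ mB; near=> w; apply/eqP; rewrite -subr_eq0 -normr_eq0; apply/eqP.
  have <- : rv (rn_norm (real_L0 k mB *: e)) w = `|rv xi w - rv eta w|.
    by near: w; exact: h.
  by near: w; exact: z.
have := sc u v (memE _ Sxi) (memE _ Seta) uv.
rewrite /u /v (lattice_norm_abs (absE xi) Sxi) (lattice_norm_abs (absE eta) Seta).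
move=> /(_ Nxi Neta); apply: le_lt_trans; rewrite le_eqVlt; apply/orP; left; apply/eqP.
apply: lattice_norm_abs; last exact: (lattice_norm_midpoint_mem (memE _ Sxi) (memE _ Seta)).
have mD : measurable_fun setT (fun w => rv xi w + rv eta w).
  by apply: measurable_funD; exact: measurable_rv.
have uvE : u + v = real_L0 k mD *: e.
  by rewrite -scalerDl; congr (_ *: _); apply/esym/real_L0D.
have half0 : 0 <= 2^-1 :> R by rewrite invr_ge0.
have hS := rv_scale_norm (xi + eta) half0; have hD := rvD xi eta.
have hh := rv_norm_half (u + v); have hn := normE _ mD; near=> w.
have -> : `|rv ((2^-1 : scalar R RealScalars) *: (xi + eta)) w| =
    2^-1 * `|rv (xi + eta) w| by near: w; exact: hS.
have -> : rv (xi + eta) w = rv xi w + rv eta w by near: w; exact: hD.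
have -> : rv (rn_norm ((2^-1 : scalar R k) *: (u + v : restrict_scalars E) : E)) w =
    2^-1 * rv (rn_norm (u + v)) w by near: w; exact: hh.
have -> : rv (rn_norm (u + v)) w = `|rv xi w + rv eta w|.
  by rewrite uvE; near: w; exact: hn.
by rewrite normrM normr_id (ger0_norm half0).
Unshelve. all: by end_near. Qed.

(** If two points of the random unit sphere have a midpoint of norm at least one on
    a non-null set [D] where they differ, then cutting them to [D] and scaling by
    the norm of the indicator yields distinct unit vectors of the module with a
    midpoint of norm one. *)
Lemma strictly_convex_random : module_strictly_convex -> random_strictly_convex E.
Proof.
move=> sc x y /random_unit_sphereP[_ ux] /random_unit_sphereP[_ uy] _.
set z := (2^-1 : scalar R k)%:A *: (x + y).
pose D := B_set x y `&` [set w | 1 <= rv (rn_norm z) w].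
have mD : measurable D.
  apply: measurableI.
    by do 2?apply: measurableI; exact: measurable_A_set.
  have -> : [set w | 1 <= rv (rn_norm z) w] = rv (rn_norm z) @^-1` [set` `[1, +oo[].
    by apply/seteqP; split=> w /=; rewrite in_itv /= andbT.
  by rewrite -[X in measurable X]setTI; apply: measurable_rv.
suff /(ae_not_null _ mD) : P D = 0%E.
  by apply: filterS => w nD Bw; rewrite ltNge; apply/negP => zw; apply: nD.
have [//|PD0] := eqVneq (P D) 0%E; exfalso.
have PD : (0 < P D)%E by rewrite lt0e PD0 /=.
have c0 := lattice_norm_indic_gt0 LN mD PD.
set c := N _ in c0; have ic0 : 0 < c^-1 by rewrite invr_gt0.
pose f w : R := c^-1 * \1_D w.
have mf : measurable_fun setT f.
  by apply: measurable_funM => //; exact: measurable_indic.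
have f0 w : 0 <= f w by rewrite /f indicE mulr_ge0// ltW.
have SD : S (L0_indic RealScalars mD) by exact: (lattice_indic LN).
have hI := rv_scale_norm (L0_indic RealScalars mD) (ltW ic0).
have hD := rv_indic P mD.
have indE : {ae P, forall w, `|rv ((c^-1 : scalar R RealScalars) *:
    (L0_indic RealScalars mD : L0 P RealScalars)) w| = f w}.
  near=> w; have -> : `|rv ((c^-1 : scalar R RealScalars) *:
    (L0_indic RealScalars mD : L0 P RealScalars)) w| =
    c^-1 * `|rv (L0_indic RealScalars mD : L0 P RealScalars) w|.
    by near: w; exact: hI.
  have -> : rv (L0_indic RealScalars mD : L0 P RealScalars) w = \1_D w.
    by near: w; exact: hD.
  by rewrite /f indicE ger0_norm.
have ScD : S ((c^-1 : scalar R RealScalars) *: L0_indic RealScalars mD).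
  exact: (lattice_scale LN).
have NcD : N ((c^-1 : scalar R RealScalars) *: L0_indic RealScalars mD) = 1.
  by rewrite lattice_norm_scale// mulVf// gt_eqF.
have cutE (v : E) : zero_one_norm v -> (forall w, D w -> A_set v w) ->
  {ae P, forall w, `|rv (rn_norm (real_L0 k mf *: v)) w| =
    `|rv ((c^-1 : scalar R RealScalars) *:
          (L0_indic RealScalars mD : L0 P RealScalars)) w|}.
  move=> uv DA; have h := rv_normM mf v; near=> w.
  have -> : `|rv ((c^-1 : scalar R RealScalars) *:
      (L0_indic RealScalars mD : L0 P RealScalars)) w| = f w.
    by near: w; exact: indE.
  have -> : rv (rn_norm (real_L0 k mf *: v)) w = `|f w| * rv (rn_norm v) w.
    by near: w; exact: h.
  rewrite normrM normr_id (ger0_norm (f0 w)) /f indicE.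
  have [/set_mem/DA wv|_] := boolP (w \in D); last by rewrite mulr0 mul0r.
  have [v0|->] : rv (rn_norm v) w = 0 \/ rv (rn_norm v) w = 1 by near: w; exact: uv.
    by move: wv; rewrite /A_set /L0_supp /= v0 eqxx.
  by rewrite normr1 mulr1.
have cx := cutE x ux (fun w (Dw : D w) => Dw.1.1.1).
have cy := cutE y uy (fun w (Dw : D w) => Dw.1.1.2).
set u := real_L0 k mf *: x in cx; set v := real_L0 k mf *: y in cy.
have Su : S (rn_norm u).
  by apply: (lattice_solid LN) ScD; apply: filterS cx => w ->.
have Sv : S (rn_norm v).
  by apply: (lattice_solid LN) ScD; apply: filterS cy => w ->.
have Nu : N (rn_norm u) = 1 by rewrite (lattice_norm_abs cx ScD).
have Nv : N (rn_norm v) = 1 by rewrite (lattice_norm_abs cy ScD).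
have uv : u <> v.
  move=> /eqP; rewrite -subr_eq0 -scalerBr => /eqP/rv_norm_eq0 z0.
  move/negP: PD0; apply; apply/eqP/(ae_not_null _ mD).
  have h := rv_normM mf (x - y); near=> w => Dw.
  have : rv (rn_norm (real_L0 k mf *: (x - y))) w = 0 by near: w; exact: z0.
  have -> : rv (rn_norm (real_L0 k mf *: (x - y))) w =
    `|f w| * rv (rn_norm (x - y)) w by near: w; exact: h.
  move=> /eqP; rewrite mulf_eq0 normr_eq0 /f indicE mem_set// mulr1.
  by rewrite gt_eqF//=; apply/negP; exact: Dw.1.2.
have := sc u v Su Sv uv Nu Nv; apply/negP; rewrite -leNgt -[leLHS]Nu.
apply: (lattice_norm_solid LN); last exact: lattice_norm_midpoint_mem.
have hm : {ae P, forall w,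
    rv (rn_norm ((2^-1 : scalar R k) *: (u + v : restrict_scalars E) : E)) w =
    f w * rv (rn_norm z) w}.
  have h1 := rv_normM mf z.
  have -> : (2^-1 : scalar R k) *: (u + v : restrict_scalars E) = real_L0 k mf *: z :> E.
    by rewrite restrict_scalarsE /u /v /z -scalerDr !scalerA mulrC.
  by apply: filterS h1 => w ->; rewrite ger0_norm.
near=> w.
have -> : rv (rn_norm ((2^-1 : scalar R k) *: (u + v : restrict_scalars E) : E)) w =
    f w * rv (rn_norm z) w by near: w; exact: hm.
have -> : `|rv (rn_norm u) w| = f w.
  have -> : `|rv (rn_norm u) w| = `|rv ((c^-1 : scalar R RealScalars) *:
      (L0_indic RealScalars mD : L0 P RealScalars)) w| by near: w; exact: cx.
  by near: w; exact: indE.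
apply: le_trans (ler_norm _); rewrite /f indicE.
have [/set_mem Dw|_] := boolP (w \in D); last by rewrite mulr0 mul0r.
by rewrite mulr1 ler_peMr ?(ltW ic0)//; exact: Dw.2.
Unshelve. all: by end_near. Qed.

(** When the random norms differ, strict convexity of [S] applies to them directly.
    When they agree, the midpoint [z] has a smaller random norm, different from
    that of [x]; if both had norm one, their own midpoint would be squeezed
    between [z] and [x] and would have norm one as well. *)
Lemma random_lattice_strictly_convex :
  strictly_convex S N -> random_strictly_convex E -> module_strictly_convex.
Proof.
move=> sc rsc x y /= Sx Sy xy Nx Ny.
set z := (2^-1 : scalar R k)%:A *: ((x : E) + (y : E)).
have zle := rv_norm_midpoint_le (x : E) (y : E).
have Sm := lattice_half LN Sx Sy.
have [nxy|nxy] := eqVneq (rn_norm (x : E)) (rn_norm (y : E)); last first.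
  apply: le_lt_trans (sc _ _ Sx Sy (elimN eqP nxy) Nx Ny).
  exact: (lattice_norm_solid LN zle).
have h0x := rv_norm_ge0 (x : E); have h0z := rv_norm_ge0 z.
have zx : {ae P, forall w, rv (rn_norm z) w <= rv (rn_norm (x : E)) w}.
  have hh := rv_norm_half ((x : E) + (y : E)).
  have tri := rv_norm_triangle (x : E) (y : E).
  rewrite -nxy in tri; near=> w.
  have -> : rv (rn_norm z) w = 2^-1 * rv (rn_norm ((x : E) + (y : E))) w.
    by near: w; exact: hh.
  have : rv (rn_norm ((x : E) + (y : E))) w <=
    rv (rn_norm (x : E)) w + rv (rn_norm (x : E)) w by near: w; exact: tri.
  lra.
have zx_neq := midpoint_norm_neq rsc xy nxy.
have absle : {ae P, forall w, `|rv (rn_norm z) w| <= `|rv (rn_norm (x : E)) w|}.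
  near=> w; have z0 : 0 <= rv (rn_norm z) w by near: w; exact: h0z.
  by rewrite (ger0_norm z0); apply: le_trans (ler_norm _); near: w; exact: zx.
have Sz : S (rn_norm z) := lattice_solid LN absle Sx.
have Nz1 : N (rn_norm z) <= 1 by rewrite -Nx; exact: (lattice_norm_solid LN).
rewrite lt_neqAle Nz1 andbT; apply/eqP => Nz.
have := sc _ _ Sz Sx zx_neq Nz Nx; apply/negP; rewrite -leNgt -[leLHS]Nz.
apply: (lattice_norm_solid LN); last exact: (lattice_half LN).
have half0 : 0 <= 2^-1 :> R by rewrite invr_ge0.
have hS := rv_scale_norm (rn_norm z + rn_norm (x : E)) half0.
have hD := rvD (rn_norm z) (rn_norm (x : E)).
near=> w.
have -> : `|rv ((2^-1 : scalar R RealScalars) *: (rn_norm z + rn_norm (x : E))) w| =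
    2^-1 * `|rv (rn_norm z + rn_norm (x : E)) w| by near: w; exact: hS.
have -> : rv (rn_norm z + rn_norm (x : E)) w = rv (rn_norm z) w + rv (rn_norm (x : E)) w.
  by near: w; exact: hD.
have z0 : 0 <= rv (rn_norm z) w by near: w; exact: h0z.
have x0 : 0 <= rv (rn_norm (x : E)) w by near: w; exact: h0x.
have : rv (rn_norm z) w <= rv (rn_norm (x : E)) w by near: w; exact: zx.
rewrite (ger0_norm z0) (ger0_norm (addr_ge0 z0 x0)); lra.
Unshelve. all: by end_near. Qed.

End strict_convexity.

Theorem theorem5p1 (R : realType) (d : measure_display) (T : measurableType d)
    (P : probability T R) (k : scalar_kind) (E : rnModType P k)
    (Phi : R -> \bar R) (N : L0 P RealScalars -> R)
    (E_complete : complete_uniform (eps_lambda E))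
    (E_full : full_support E)
    (Phi_young : young_function Phi)
    (Phi_real : real_valued Phi)
    (N_norm : N = luxemburg_norm Phi \/ N = orlicz_norm Phi) :
  strictly_convex (orlicz_module Phi E) (fun x => N (rn_norm (x : E)))
  <->
  strictly_convex (orlicz_space P Phi) N /\ random_strictly_convex E.
Proof.
have LN : lattice_norm (orlicz_space P Phi) N.
  by case: N_norm => ->; [exact: luxemburg_lattice_norm|exact: orlicz_lattice_norm].
have [e e1] := exists_unit_norm E_complete E_full.
split=> [sc|[scN rscE]]; last exact: (random_lattice_strictly_convex LN scN rscE).
split; first exact: (strictly_convex_lattice LN e1 sc).
exact: (strictly_convex_random LN sc).
Qed.
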